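(* Let $\Gamma$ be a finitely generated group that admits a descending chain $\Gamma_0\supseteq\Gamma_1\supseteq\Gamma_2\supseteq\dots$ of finite-index normal subgroups of $\Gamma$ with $\Gamma_k\cong\Gamma$ for all $k\geq 0$. Set $\Gamma_\infty:=\bigcap_k \Gamma_k$. Then for all sufficiently large $l$, the group $\Gamma_l/\Gamma_\infty$ is free abelian. In particular, for such $l$, $\Gamma_l$ admits a surjection $\pi:\Gamma_l\twoheadrightarrow A$ onto a free abelian group $A$ such that there are finite-index subgroups $A_k\subseteq A$ with $\Gamma_k=\pi^{-1}(A_k)$ for every $k\geq l$.
   Context: The isomorphisms $\Gamma_k\cong\Gamma$ are isomorphisms of abstract groups. The trivial group counts as free abelian (of rank $0$). *)

(* Defs.v *)
From HB Require Import structures.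
From mathcomp Require Import all_boot all_algebra.
From mathcomp Require Import boolp classical_sets functions cardinality.
From mathcomp Require Import freeg.

Set Implicit Arguments.
Unset Strict Implicit.
Unset Printing Implicit Defensive.

Local Open Scope group_scope.
Local Open Scope quotient_scope.

(* A subgroup of a (possibly infinite) group G is a [groupClosed G].  Subsets
   are boolean predicates; this loses nothing in classical logic. *)

HB.mixin Record isNormalClosed (G : groupType) (S : {pred G}) := {
  gpredJ_normal : forall x y : G, x \in S -> x ^ y \in S
}.

#[short(type="normalClosed")]
HB.structure Definition NormalClosed (G : groupType) :=
  {S of isNormalClosed G S & GroupClosed G S}.

Definition subg_type (G : groupType) (H : groupClosed G) : Type :=
  {x : G | x \in H}.

Section SubgType.
Variables (G : groupType) (H : groupClosed G).

HB.instance Definition _ := SubChoice.on (subg_type H).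

Fact subg_group_closed : group_closed H.
Proof. by split; [exact: gpred1 | exact: gpredF]. Qed.

HB.instance Definition _ :=
  SubChoice_isSubGroup.Build G (mem H) (subg_type H) subg_group_closed.
End SubgType.

Definition bigcapg_pred (G : groupType) (I : Type) (F : I -> normalClosed G) :
  {pred G} := [pred x | `[< forall i, x \in F i >]].

Section Bigcapg.
Variables (G : groupType) (I : Type) (F : I -> normalClosed G).

Fact bigcapgP (x : G) : reflect (forall i, x \in F i) (x \in bigcapg_pred F).
Proof. by apply: (iffP idP) => [/asboolP//|Fx]; apply/asboolP. Qed.

Fact bigcapgV : invg_closed (bigcapg_pred F).
Proof.
by move=> x /bigcapgP Fx; apply/bigcapgP => i; rewrite gpredV; exact: Fx.
Qed.

Fact bigcapg1 : 1 \in bigcapg_pred F.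
Proof. by apply/bigcapgP => i; exact: gpred1. Qed.

Fact bigcapgM : mulg_closed (bigcapg_pred F).
Proof.
move=> x y /bigcapgP Fx /bigcapgP Fy; apply/bigcapgP => i.
by apply: gpredM; [exact: Fx | exact: Fy].
Qed.

Fact bigcapgJ (x y : G) : x \in bigcapg_pred F -> x ^ y \in bigcapg_pred F.
Proof.
by move=> /bigcapgP Fx; apply/bigcapgP => i; apply/gpredJ_normal/Fx.
Qed.

(* HB builds the join structures only if multiplication comes first. *)
HB.instance Definition _ := isMulClosed.Build G (bigcapg_pred F) bigcapgM.
HB.instance Definition _ := isMul1Closed.Build G (bigcapg_pred F) bigcapg1.
HB.instance Definition _ := isInvClosed.Build G (bigcapg_pred F) bigcapgV.
HB.instance Definition _ := isNormalClosed.Build G (bigcapg_pred F) bigcapgJ.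

Definition bigcapg : normalClosed G :=
  NormalClosed.clone G (bigcapg_pred F) _.
End Bigcapg.

(* The trace of N on H, as a normal subgroup of the group H. *)
Definition traceg_pred (G : groupType) (H : groupClosed G) (N : normalClosed G) :
  {pred subg_type H} := [pred u | val u \in N].

Arguments traceg_pred [G] H N.

Section Traceg.
Variables (G : groupType) (H : groupClosed G) (N : normalClosed G).

Fact tracegV : invg_closed (traceg_pred H N).
Proof. by move=> u; rewrite !inE gmulfV gpredV. Qed.

Fact traceg1 : 1 \in traceg_pred H N.
Proof. by rewrite inE gmulf1 gpred1. Qed.

Fact tracegM : mulg_closed (traceg_pred H N).
Proof. by move=> u v; rewrite !inE gmulfM; exact: gpredM. Qed.

Fact tracegJ (u v : subg_type H) : u \in traceg_pred H N -> u ^ v \in traceg_pred H N.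
Proof. by rewrite !inE gmulfJ; exact: gpredJ_normal. Qed.

HB.instance Definition _ := isMulClosed.Build _ (traceg_pred H N) tracegM.
HB.instance Definition _ := isMul1Closed.Build _ (traceg_pred H N) traceg1.
HB.instance Definition _ := isInvClosed.Build _ (traceg_pred H N) tracegV.
HB.instance Definition _ := isNormalClosed.Build _ (traceg_pred H N) tracegJ.

Definition traceg : normalClosed (subg_type H) :=
  NormalClosed.clone (subg_type H) (traceg_pred H N) _.
End Traceg.

Arguments traceg [G] H N.

Section Quotg.
Variables (G : groupType) (N : normalClosed G).

Definition eqmodg (x y : G) : bool := x^-1 * y \in N.

Fact eqmodg_refl : reflexive eqmodg.
Proof. by move=> x; rewrite /eqmodg mulVg gpred1. Qed.

Fact eqmodg_sym : symmetric eqmodg.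
Proof. by move=> x y; rewrite /eqmodg -gpredV invgM invgK. Qed.

Fact eqmodg_trans : transitive eqmodg.
Proof.
by move=> y x z xy yz; rewrite /eqmodg -(mulgK y x^-1) -mulgA gpredM.
Qed.

Canonical eqmodg_equiv := EquivRel eqmodg eqmodg_refl eqmodg_sym eqmodg_trans.
Canonical eqmodg_encModRel := defaultEncModRel eqmodg.

Definition quotg := {eq_quot eqmodg}.

HB.instance Definition _ := Choice.on quotg.
HB.instance Definition _ := Quotient.on quotg.
HB.instance Definition _ := EqQuotient.on quotg.

Definition quotg_mul (u v : quotg) : quotg := \pi_quotg (repr u * repr v).
Definition quotg_one : quotg := \pi_quotg 1.
Definition quotg_inv (u : quotg) : quotg := \pi_quotg (repr u)^-1.

Fact quotg_eqP (x y : G) : reflect (\pi_quotg x = \pi_quotg y) (eqmodg x y).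
Proof. by apply: (iffP idP) => [/eqmodP|/eqmodP]. Qed.

Fact quotg_repr (x : G) : eqmodg (repr (\pi_quotg x)) x.
Proof. by apply/quotg_eqP; rewrite reprK. Qed.

Fact quotg_mulE (x y : G) :
  quotg_mul (\pi_quotg x) (\pi_quotg y) = \pi_quotg (x * y).
Proof.
apply/quotg_eqP; rewrite /eqmodg invgM.
have hx := quotg_repr x; have hy := quotg_repr y; rewrite /eqmodg in hx hy.
set a := repr _ in hx *; set b := repr _ in hy *.
have -> : b^-1 * a^-1 * (x * y) = (a^-1 * x) ^ b * (b^-1 * y).
  by rewrite /conjg !mulgA mulgK.
by rewrite gpredM // gpredJ_normal.
Qed.

Fact quotg_invE (x : G) : quotg_inv (\pi_quotg x) = \pi_quotg x^-1.
Proof.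
apply/quotg_eqP; rewrite /eqmodg invgK.
have := quotg_repr x; rewrite eqmodg_sym /eqmodg.
move=> /(fun h => gpredJ_normal _ x^-1 h).
by rewrite /conjg invgK -mulgA mulVKg.
Qed.

Fact quotg_mulA : associative quotg_mul.
Proof.
elim/quotW=> x; elim/quotW=> y; elim/quotW=> z.
by rewrite (quotg_mulE y z) (quotg_mulE x y) !quotg_mulE mulgA.
Qed.

Fact quotg_mul1g : left_id quotg_one quotg_mul.
Proof. by elim/quotW=> x; rewrite quotg_mulE mul1g. Qed.

Fact quotg_mulg1 : right_id quotg_one quotg_mul.
Proof. by elim/quotW=> x; rewrite quotg_mulE mulg1. Qed.

Fact quotg_mulVg : left_inverse quotg_one quotg_inv quotg_mul.
Proof. by elim/quotW=> x; rewrite quotg_invE quotg_mulE mulVg. Qed.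

Fact quotg_mulgV : right_inverse quotg_one quotg_inv quotg_mul.
Proof. by elim/quotW=> x; rewrite quotg_invE quotg_mulE mulgV. Qed.

HB.instance Definition _ := isGroup.Build quotg
  quotg_mulA quotg_mul1g quotg_mulg1 quotg_mulVg quotg_mulgV.
End Quotg.

(* H / N as a group; meant for N contained in H, since the quotient is by the
   intersection of N with H. *)
Definition subquotg (G : groupType) (H : groupClosed G) (N : normalClosed G) :
  groupType := quotg (traceg H N).

Definition finitely_generated (G : groupType) : Prop :=
  exists s : seq G,
    forall H : groupClosed G, {subset s <= H} -> forall x : G, x \in H.

Definition lcoset (G : groupType) (H : groupClosed G) (x : G) : set G :=
  [set y | x^-1 * y \in H]%classic.

Definition finite_index (G : groupType) (H : groupClosed G) : Prop :=
  finite_set (range (lcoset H)).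

Definition isomorphic (G H : groupType) : Prop :=
  exists f : UMagmaMorphism.type G H, bijective f.

(* [{freeg K / int}] is the additive group of finite formal Z-linear
   combinations of elements of K; K may be empty or infinite. *)
Definition free_abelian (A : groupType) : Prop :=
  exists (K : choiceType) (f : A -> {freeg K / int}),
    bijective f /\ (forall x y : A, f (x * y) = (f x + f y)%R).

(* Main.v *)
From HB Require Import structures.
Require Import Defs.
From mathcomp Require Import all_boot all_order all_algebra.
From mathcomp Require Import zify.
From mathcomp Require Import boolp classical_sets functions cardinality.
From mathcomp Require Import freeg.

Set Implicit Arguments.
Unset Strict Implicit.
Unset Printing Implicit Defensive.

Import Order.TTheory GRing.Theory Num.Theory.

(** Write [phi k] for an isomorphism of the group [T] onto [Gam k], seen as an
injective endomorphism of [T].  The heart of the matter is that the derived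
subgroup of [Gam l] lies in every [Gam k] once [l] is large
([chain_eventually_abelian]).  Given this, [Gam l] modulo the intersection is a
finitely generated abelian group; its torsion subgroup is finite and meets
[Gam l'] trivially modulo the intersection for some [l'], after which the
quotients are torsion-free, hence free.

The difficulty is uniformity in [k], for which there are two tools.

Finiteness of small index.  A characteristic quotient of [Gam k] of bounded
order has the same order for all [k], so [T] acts on it through a group of
bounded order.  As a finitely generated group has finitely many subgroups of a
given index, a single subgroup of finite index acts trivially on all these
quotients, and then, for [l] large, [Gam l] acts on each of them as [Gam k]
does ([action_stabilises]).

Noetherianity.  Finitely generated abelian groups, and the quotient
of the first by the second derived subgroup of [T] as a module over the integral
group ring of the abelianisation, are Noetherian.  This bounds exponents and orders of torsion sections by
numbers that depend on the isomorphism type of [T] only, simultaneously for all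
primes.

The proof has four steps.  (a) [chain_eventually_central]: for
[l] large, [Gam l] acts trivially on the abelianisation of [Gam k].  Indeed the
first Betti numbers of [Gam k] and [T] agree, so commutators of [Gam k] with
[T] are torsion in that abelianisation, and torsion of bounded exponent is seen
in a bounded finite quotient.  (b) [self_cover_solvable]: [T / Gam k] is
solvable.  This is a counting argument with the solvable radical of the
quotient of [T] by the intersection of its normal subgroups of bounded index.  (c)
[chain_class_two]: nilpotent quotients of [Gam l / Gam k] are abelian, by a
uniform bound on the exponent of a quotient of the second factor of the lower
central series.  (d) [cover_metabelian_index]: under (a) and (c), the derived
subgroup of the largest metabelian quotient of [Gam l / Gam k] has bounded
order.  A bounded order allows [action_stabilises] to be used once more: the
action of [Gam l] on that finite group is trivial, which by (c) forces the
group itself to be trivial.  So the derived subgroup of [Gam l / Gam k] is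
perfect, and by (b) it is trivial. *)

(** * Noetherian modules *)
Lemma mem_tail (T : eqType) (x y : T) s : y \in s -> y \in x :: s.
Proof. by rewrite inE orbC => ->. Qed.

Section Modules.
Local Open Scope ring_scope.
Local Open Scope classical_set_scope.
Variable R : comNzRingType.
Implicit Types V : lmodType R.

Record is_submod V (U : set V) : Prop := IsSubmod {
  submod0 : U 0;
  submodD : forall x y, U x -> U y -> U (x + y);
  submodZ : forall r x, U x -> U (r *: x) }.

Lemma submodN V (U : set V) x : is_submod U -> U x -> U (- x).
Proof. by move=> hU Ux; rewrite -scaleN1r; apply: submodZ. Qed.

Lemma submodB V (U : set V) x y : is_submod U -> U x -> U y -> U (x - y).
Proof. by move=> hU Ux Uy; apply: submodD => //; apply: submodN. Qed.

(** Impredicative, so that a property of all elements of the span is proved by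
showing that it defines a submodule. *)
Definition lspan V (s : seq V) (x : V) : Prop :=
  forall U : set V, is_submod U -> (forall y, y \in s -> U y) -> U x.

Lemma lspan_submod V (s : seq V) : is_submod (lspan s).
Proof.
split=> [U hU sU|x y hx hy U hU sU|r x hx U hU sU].
- exact: submod0.
- by apply: submodD; [|apply: hx|apply: hy].
- by apply: submodZ => //; apply: hx.
Qed.

Lemma mem_lspan V (s : seq V) x : x \in s -> lspan s x.
Proof. by move=> xs U _; apply. Qed.

Lemma lspan_nil V (x : V) : lspan [::] x -> x = 0.
Proof.
move=> hx; apply: (hx [set x | x = 0]) => //.
by split=> [|y z -> ->|r y ->] //=; rewrite ?addr0 ?scaler0.
Qed.

Lemma lspan_cons V (x : V) s y : lspan (x :: s) y ->
  exists r z, lspan s z /\ y = r *: x + z.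
Proof.
move=> hy; apply: (hy [set y | exists r z, lspan s z /\ y = r *: x + z]).
  split=> /= [|y1 y2 [r1 [z1 [h1 ->]]] [r2 [z2 [h2 ->]]]|r y1 [r1 [z1 [h1 ->]]]].
  - exists 0, 0; split; last by rewrite scale0r addr0.
    exact: submod0 (lspan_submod s).
  - exists (r1 + r2), (z1 + z2); split; last by rewrite scalerDl addrACA.
    exact: submodD (lspan_submod s) _ _ h1 h2.
  - exists (r * r1), (r *: z1); split; last by rewrite scalerDr scalerA.
    exact: submodZ (lspan_submod s) _ _ h1.
move=> z; rewrite inE => /orP[/eqP->|zs] /=.
  exists 1, 0; split; last by rewrite scale1r addr0.
  exact: submod0 (lspan_submod s).
by exists 0, z; split; [exact: mem_lspan|rewrite scale0r add0r].
Qed.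

Definition fg_submod V (U : set V) :=
  exists s : seq V, (forall x, x \in s -> U x) /\ (forall x, U x -> lspan s x).

Definition noetherian V := forall U : set V, is_submod U -> fg_submod U.

Definition finite_module V := exists s : seq V, forall x, lspan s x.

(** The union of the chain is generated by finitely many elements, and these
occur together at some stage. *)
Lemma noetherian_acc V (U : nat -> set V) : noetherian V ->
  (forall i, is_submod (U i)) -> (forall i x, U i x -> U i.+1 x) ->
  exists n, forall i x, U i x -> U n x.
Proof.
move=> noeV hU mono.
have mono' i j x : (i <= j)%N -> U i x -> U j x.
  by move=> /subnKC <-; elim: (j - i)%N => [|k IH]; rewrite ?addn0 ?addnS //; auto.
have [] := noeV [set x | exists i, U i x].
  split=> [|x y [i Ux] [j Uy]|r x [i Ux]].
  - by exists 0%N; apply: submod0.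
  - exists (maxn i j); apply: submodD => //.
      exact: mono' (leq_maxl i j) Ux.
    exact: mono' (leq_maxr i j) Uy.
  - by exists i; apply: submodZ.
move=> s [sU Us].
have [n hn] : exists n, forall x, x \in s -> U n x.
  elim: s sU {Us} => [|x s IH] sU; first by exists 0%N.
  have [n hn] := IH (fun y ys => sU y (mem_tail x ys)).
  have [i Ux] := sU x (mem_head _ _).
  exists (maxn i n) => y; rewrite inE => /orP[/eqP->|ys].
    exact: mono' (leq_maxl i n) Ux.
  exact: mono' (leq_maxr i n) (hn y ys).
by exists n => i x Ux; apply: (Us x); [exists i|exact: hU|exact: hn].
Qed.

(** Induction on the generators: the coefficients of the first generator in
elements of [U] form an ideal, and the elements of [U] in which it does not
occur lie in the span of the other generators. *)
Lemma finite_module_noetherian V : noetherian R^o -> finite_module V ->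
  noetherian V.
Proof.
move=> noeR [s hs] U hU; suff: forall U, is_submod U ->
    (forall x, U x -> lspan s x) -> fg_submod U by apply=> // x _.
elim: s {hs U hU} => [|x s IH] U hU Us.
  exists [::]; split=> // y /Us /lspan_nil ->; exact: submod0 (lspan_submod _).
have hs := lspan_submod s.
have [] := IH [set y | U y /\ lspan s y].
- split=> [|y z [? ?] [? ?]|r y [? ?]]; split.
  + exact: submod0. + exact: submod0 hs.
  + exact: submodD. + exact: submodD hs _ _ _ _.
  + exact: submodZ. + exact: submodZ hs _ _ _.
- by move=> y [].
move=> t [tU Ut].
have [] := noeR [set r : R^o | exists y, lspan s y /\ U (r *: x + y)].
  split=> /= [|r1 r2 [y1 [s1 U1]] [y2 [s2 U2]]|r r1 [y1 [s1 U1]]].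
  - by exists 0; rewrite scale0r addr0; split; [apply: submod0|apply: submod0].
  - exists (y1 + y2); split; first exact: submodD hs _ _ _ _.
    by rewrite scalerDl addrACA; apply: submodD.
  - exists (r *: y1); split; first exact: submodZ hs _ _ _.
    by rewrite -scalerA -scalerDr; apply: submodZ.
move=> rs [rsJ Jrs].
have [us [usU usW]] : exists us : seq V, (forall u, u \in us -> U u) /\
    forall r, r \in rs -> exists2 u, u \in us & lspan s (u - r *: x).
  elim: rs rsJ {Jrs} => [|r rs IHr] rsJ; first by exists [::].
  have [us [usU usW]] := IHr (fun r0 h => rsJ r0 (mem_tail r h)).
  have [y [sy Uy]] := rsJ r (mem_head _ _).
  exists (r *: x + y :: us); split.
    by move=> u; rewrite inE => /orP[/eqP->|/usU].
  move=> r0; rewrite inE => /orP[/eqP->|/usW[u uus su]].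
    by exists (r *: x + y); rewrite ?mem_head// addrC addKr.
  by exists u; rewrite // inE uus orbT.
exists (us ++ t); split.
  by move=> y; rewrite mem_cat => /orP[/usU|/tU[]].
move=> u Uu W hW usWW.
have [r [z [sz ue]]] := lspan_cons (Us u Uu).
have [|||y [sy [Uy Wy]]] := Jrs r _ [set r : R^o |
    exists y, lspan s y /\ (U (r *: x + y) /\ W (r *: x + y))].
- by exists z; rewrite -ue.
- split=> /= [|r1 r2 [y1 [s1 [U1 W1]]] [y2 [s2 [U2 W2]]]|r0 r1 [y1 [s1 [U1 W1]]]].
  - exists 0; rewrite scale0r addr0; do ?split; exact: submod0.
  - exists (y1 + y2); split; first exact: submodD hs _ _ _ _.
    by rewrite scalerDl addrACA; split; apply: submodD.
  - exists (r0 *: y1); split; first exact: submodZ hs _ _ _.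
    by rewrite -scalerA -scalerDr; split; apply: submodZ.
- move=> r0 /usW[u0 u0us su0]; exists (u0 - r0 *: x); split=> //.
  rewrite addrC subrK; split; first exact: usU.
  by apply: usWW; rewrite mem_cat u0us.
have /(_ W hW) Wt : lspan t (u - (r *: x + y)).
  apply: Ut; split; first exact: submodB.
  by rewrite ue opprD addrACA subrr add0r; exact: submodB hs sz sy.
rewrite -(subrK (r *: x + y) u); apply: submodD => //; apply: Wt => v vt.
by apply: usWW; rewrite mem_cat vt orbT.
Qed.

(** The elements with finitely many multiples form a submodule, and a finitely
generated such submodule is finite.  All finite submodules lie in this one
finite set, which bounds their orders at once. *)
Lemma noetherian_finite_part V : noetherian V ->
  finite_set [set x : V | finite_set [set r *: x | r in [set: R]]].
Proof.
move=> noeV; have [] := noeV [set x : V | finite_set [set r *: x | r in [set: R]]].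
  split=> /= [|x y fx fy|r x fx].
  - apply: (sub_finite_set (B := [set 0])) => //.
    by move=> _ [r _ <-]; rewrite /= scaler0.
  - apply: (sub_finite_set (B := [set u + v | u in [set r *: x | r in [set: R]] &
      v in [set r *: y | r in [set: R]]])); last exact: finite_image2.
    move=> _ [r _ <-]; exists (r *: x); first by exists r.
    by exists (r *: y); [exists r|rewrite scalerDr].
  - apply: (sub_finite_set (B := [set r *: x | r in [set: R]])) => //.
    by move=> _ [r0 _ <-]; exists (r0 * r); rewrite ?scalerA.
move=> s [sF Fs].
apply: (sub_finite_set (B := [set x | lspan s x])); first exact: Fs.
elim: s sF {Fs} => [|x s IH] sF.
  apply: (sub_finite_set (B := [set 0])) => // y /lspan_nil -> //.
apply: (sub_finite_set (B := [set u + v | u in [set r *: x | r in [set: R]] &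
      v in lspan s])).
  move=> y /lspan_cons[r [z [sz ->]]]; exists (r *: x); first by exists r.
  by exists z.
apply: finite_image2; first exact: sF (mem_head _ _).
by apply: IH => y ys; apply: sF; rewrite inE ys orbT.
Qed.

Definition is_ideal (I : set R) := @is_submod R^o I.

(** The determinant trick: if [r] maps the span of [s] into [I] times this span
modulo [Z], then some [r ^+ j + a] with [a] in [I] maps it into [Z].  In place of
a determinant, the generators are eliminated one at a time, the elements
[r ^+ j + a] being closed under products. *)
Lemma ideal_nakayama V (I : set R) (Z : set V) (r : R) (s : seq V) :
  is_ideal I -> is_submod Z ->
  (forall x, x \in s -> forall W : set V, is_submod W ->
     (forall z, Z z -> W z) ->
     (forall a y, I a -> y \in s -> W (a *: y)) -> W (r *: x)) ->
  exists j a, I a /\ forall x, x \in s -> Z ((r ^+ j + a) *: x).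
Proof.
move=> hI hZ hs.
(* [D t] is the submodule [I * t + Z], with coefficients given one by one. *)
pose D := fix D (s : seq V) : set V := if s is x :: s' then
  [set m | exists2 a, I a & D s' (m - a *: x)] else Z.
have hD t : is_submod (D t).
  elim: t => [|x t IH] //=; split=> /= [|m1 m2 [a1 I1 h1] [a2 I2 h2]|b m [a Ia h]].
  - by exists 0; [exact: submod0 hI|rewrite scale0r subr0; apply: submod0].
  - exists (a1 + a2); first exact: submodD hI _ _ I1 I2.
    by rewrite scalerDl opprD addrACA; apply: submodD.
  - exists (b * a); first exact: submodZ hI b a Ia.
    by rewrite -scalerA -scalerBr; apply: submodZ.
have ZD t m : Z m -> D t m.
  elim: t m => [|x t IH] m Zm //=; exists 0; first exact: submod0 hI.
  by rewrite scale0r subr0; apply: IH.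
have ID t a x : I a -> x \in t -> D t (a *: x).
  move=> Ia; elim: t => [|y t IH] //=; rewrite inE => /orP[/eqP->|xt].
    by exists a => //; rewrite subrr; apply: submod0.
  by exists 0; [exact: submod0 hI|rewrite scale0r subr0; apply: IH].
pose S (u : R) := exists j a, I a /\ u = r ^+ j + a.
have IM a b : I a -> I (b * a) by exact: submodZ hI b a.
have S_M u v : S u -> S v -> S (u * v).
  move=> [j [a [Ia ->]]] [k [b [Ib ->]]]; exists (j + k)%N.
  exists (r ^+ j * b + (r ^+ k + b) * a); split.
    by apply: (submodD hI); apply: IM.
  by rewrite mulrDr mulrDl exprD [a * r ^+ k]mulrC mulrDl [a * b]mulrC
     mulrDl -!addrA; congr (_ + _); rewrite addrCA.
have S_B u a : S u -> I a -> S (u - a).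
  move=> [j [b [Ib ->]]] Ia; exists j, (b - a); split; last by rewrite addrA.
  exact: submodB hI Ib Ia.
suff: forall t, (forall x, x \in t -> exists2 u, S u & D t (u *: x)) ->
    exists2 u, S u & forall x, x \in t -> Z (u *: x).
  case/(_ s) => [x xs|u [j [a [Ia ->]]] hu]; last by exists j, a.
  exists r; first by exists 1%N, 0; rewrite expr1 addr0; split=> //; exact: submod0 hI.
  by apply: hs => // [z|a y Ia ys]; [exact: ZD|exact: ID].
elim=> [|x t IH] ht.
  exists 1 => //; exists 0%N, 0; rewrite expr0 addr0; split=> //.
  exact: submod0 hI.
have [u Su [a Ia hu]] := ht x (mem_head _ _).
have Su' := S_B _ _ Su Ia; rewrite -scalerBl in hu.
have [y yt|w Sw hw] := IH.
  have [|v Sv [b Ib hv]] := ht y _; first by rewrite inE yt orbT.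
  exists ((u - a) * v); first exact: S_M.
  rewrite -scalerA -(subrK (b *: x) (v *: y)) scalerDr.
  apply: (submodD (hD t)); first exact: submodZ (hD t) _ _ hv.
  by rewrite scalerA mulrC -scalerA; apply: submodZ (hD t) _ _ hu.
have wD t' m : (forall x, x \in t' -> Z (w *: x)) -> D t' m -> Z (w *: m).
  elim: t' m => [|y t' IHt] m ht'; first exact: submodZ.
  move=> [b Ib hb]; rewrite -(subrK (b *: y) m) scalerDr.
  apply: (submodD hZ).
    by apply: IHt => // z zt; apply: ht'; rewrite inE zt orbT.
  by rewrite scalerA mulrC -scalerA; apply: submodZ => //; apply: ht'; rewrite mem_head.
exists (w * (u - a)); first exact: S_M.
move=> y; rewrite inE => /orP[/eqP->|yt]; rewrite -?scalerA.
  exact: wD hu.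
by rewrite scalerA mulrC -scalerA; apply: submodZ => //; apply: hw.
Qed.

End Modules.


(** * Hilbert's basis theorem *)

Section Hilbert.
Local Open Scope ring_scope.
Local Open Scope classical_set_scope.

Lemma noetherian_int : @noetherian int int^o.
Proof.
move=> U hU; have [U0|] := pselect (forall x, U x -> x = 0).
  by exists [::]; split=> // x /U0 ->; exact: (submod0 (@lspan_submod int int^o _)).
move=> /existsNP[x0 /not_implyP[Ux0 /eqP x00]].
have UN (x : int) : U x -> U (`|x|%N%:Z).
  move=> Ux; have [x_ge0|x_lt0] := lerP 0 x; first by rewrite gez0_abs.
  by rewrite ltz0_abs//; exact: (submodN hU).
have exP : exists n, (0 < n)%N && `[< U n%:Z >].
  by exists `|x0|%N; rewrite absz_gt0 x00; apply/asboolP/UN.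
have [n /andP[n_gt0 /asboolP Un] nmin] := ex_minnP exP.
exists [:: n%:Z]; split=> [x|x Ux]; first by rewrite inE => /eqP->.
suff: (x %% n%:Z)%Z = 0.
  move=> xn0; rewrite (divz_eq x n) xn0 addr0.
  apply: (submodZ (@lspan_submod int int^o _)).
  by apply: (@mem_lspan int int^o); rewrite inE.
have n0 : n%:Z != 0 by rewrite eqz_nat -lt0n.
have Um : U (x %% n%:Z)%Z.
  have -> : (x %% n%:Z)%Z = x - (x %/ n%:Z)%Z * n%:Z by rewrite {2}(divz_eq x n) addrC addKr.
  by apply: (submodB hU) => //; exact: (submodZ hU).
apply/eqP/negPn/negP => m0.
have := nmin `|(x %% n%:Z)%Z|%N.
rewrite absz_gt0 m0; have -> /= : `[< U `|(x %% n%:Z)%Z|%N%:Z >] by apply/asboolP/UN.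
move=> /(_ isT); apply/negP; rewrite -ltnNge -ltz_nat gez0_abs ?modz_ge0//.
by rewrite ltz_pmod// ltz_nat.
Qed.

(** Hilbert's basis theorem.  The ideals [J U n] of leading coefficients in degree
at most [n] are stationary from some [n0] on; finitely many polynomials realise
generators of the first ones, and every element of [U] is reduced by them. *)
Lemma noetherian_poly (R : comNzRingType) : @noetherian R R^o ->
  @noetherian {poly R} {poly R}^o.
Proof.
move=> noeR U hU.
pose J (W : set {poly R}^o) n : set R^o :=
  [set r | exists p : {poly R}, [/\ W p, (size p <= n.+1)%N & p`_n = r]].
have hJ (W : set {poly R}^o) n : is_submod W -> is_submod (J W n).
  move=> hW; split=> /= [|r1 r2 [p1 [W1 s1 e1]] [p2 [W2 s2 e2]]|r r1 [p1 [W1 s1 e1]]].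
  - by exists 0; rewrite coef0 size_poly0; split=> //; apply: submod0 hW.
  - exists (p1 + p2); rewrite coefD e1 e2; split=> //; first exact: (submodD hW).
    by rewrite (leq_trans (size_polyD _ _))// geq_max s1.
  - exists (r%:P * p1); rewrite coefCM e1; split=> //; first exact: (submodZ hW).
    by rewrite mul_polyC (leq_trans (size_scale_leq _ _)).
have [|n0 hn0] := @noetherian_acc R R^o (J U) noeR (fun n => hJ U n hU).
  move=> n r [p [Up sp pn]]; exists ('X * p); split.
  - exact: (submodZ hU).
  - by rewrite mulrC (leq_trans (size_polyMleq _ _))// size_polyX addn2.
  - by rewrite coefXM.
have hUI (W : set {poly R}^o) : is_submod W -> is_submod (W `&` U).
  by move=> hW; split=> [|x y [? ?] [? ?]|x y [? ?]]; split;
     solve [exact: submod0|exact: submodD|exact: submodZ].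
have gen1 n : exists s : seq {poly R}^o, (forall p, p \in s -> U p) /\
    forall W, is_submod W -> (forall p, p \in s -> W p) ->
      forall r, J U n r -> J (W `&` U) n r.
  have [rs [rsJ Jrs]] := noeR _ (hJ U n hU).
  suff [s [sU hs]] : exists s : seq {poly R}^o, (forall p, p \in s -> U p) /\
      forall W : set {poly R}^o, (forall p, p \in s -> W p) ->
      forall r, r \in rs -> J (W `&` U) n r.
    exists s; split=> // W hW sW r /Jrs; apply; last exact: hs.
    exact/hJ/hUI.
  elim: rs rsJ {Jrs} => [|r rs IH] rsJ; first by exists [::].
  have [s [sU hs]] := IH (fun r0 h => rsJ r0 (mem_tail r h)).
  have [p [Up sp pr]] := rsJ r (mem_head _ _).
  exists (p :: s); split=> [q|W sW r0]; first by rewrite inE => /orP[/eqP->|/sU].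
  rewrite inE => /orP[/eqP->|r0s]; last first.
    by apply: hs => // q qs; apply: sW; apply: mem_tail.
  by exists p; split=> //; split=> //; apply: sW; rewrite mem_head.
have [s [sU hs]] : exists s : seq {poly R}^o, (forall p, p \in s -> U p) /\
    forall n W, (n <= n0)%N -> is_submod W -> (forall p, p \in s -> W p) ->
      forall r, J U n r -> J (W `&` U) n r.
  elim: {hn0} n0 => [|n [s [sU hs]]].
    have [s [sU hs]] := gen1 0%N; exists s; split=> // n W; rewrite leqn0 => /eqP->.
    exact: hs.
  have [t [tU ht]] := gen1 n.+1; exists (s ++ t); split=> [p|k W].
    by rewrite mem_cat => /orP[/sU|/tU].
  rewrite leq_eqVlt => /orP[/eqP-> hW stW|kn hW stW].
    by apply: ht => // p pt; apply: stW; rewrite mem_cat pt orbT.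
  by apply: hs => // p ps; apply: stW; rewrite mem_cat ps.
exists s; split=> // p Up W hW sW.
have [n] := ubnP (size p); elim: n => // n IH in p Up * => sp.
have [p0|p_gt0] := posnP (size p).
  by move/eqP: p0; rewrite size_poly_eq0 => /eqP->; apply: (submod0 hW).
set m := (size p).-1.
have [q [[Wq Uq] sq qm]] : exists q : {poly R}, [/\ W q /\ U q, (size q <= m.+1)%N & q`_m = p`_m].
  have Jp : J U m p`_m by exists p; split=> //; rewrite prednK.
  have [mn|mn] := leqP m n0.
    by have [q [WUq sq qm]] := hs m W mn hW sW _ Jp; exists q.
  have [q [[Wq Uq] sq qm]] := hs n0 W (leqnn _) hW sW _ (hn0 _ _ Jp).
  exists ('X^(m - n0) * q); split.
  - by split; [exact: (submodZ hW)|exact: (submodZ hU)].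
  - rewrite (leq_trans (size_polyMleq _ _))// size_polyXn addSn /=.
    by rewrite (leq_trans (leq_add (leqnn _) sq))// addnS subnK// ltnW.
  - by rewrite coefXnM ltnNge leq_subr/= subKn// ltnW.
rewrite -(subrK q p); apply: (submodD hW) => //; apply: IH.
  exact: submodB hU Up Uq.
apply: leq_ltn_trans (_ : (m < n)%N); last by rewrite prednK.
apply/leq_sizeP => j; rewrite leq_eqVlt coefB => /orP[/eqP<-|mj].
  by rewrite qm subrr.
rewrite !nth_default ?subrr//; first exact: leq_trans sq _.
by rewrite -[size p]prednK.
Qed.

(** Integer polynomials in [d] variables, as an iterated polynomial ring: both the
basis theorem and the action of commuting operators go one variable at a
time. *)
Fixpoint Zpoly (d : nat) : comNzRingType :=
  if d is d'.+1 then {poly (Zpoly d')} else int.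

Lemma noetherian_Zpoly d : @noetherian (Zpoly d) (Zpoly d)^o.
Proof. by elim: d => [|d IH]; [exact: noetherian_int|exact: noetherian_poly]. Qed.

End Hilbert.

(** * Commuting operators as polynomial rings of scalars *)

Section Action.
Local Open Scope ring_scope.
Local Open Scope classical_set_scope.

Section Zsub.
Variable V : zmodType.
Implicit Types (U : set V) (x y : V).

Record is_zsub U : Prop := {
  zsub0 : U 0;
  zsubD : forall x y, U x -> U y -> U (x + y);
  zsubN : forall x, U x -> U (- x) }.

Lemma zsubMn U x n : is_zsub U -> U x -> U (x *+ n).
Proof. by move=> hU Ux; elim: n => [|n IH]; [exact: zsub0|rewrite mulrS; apply: zsubD]. Qed.

End Zsub.

Record is_action (R : comNzRingType) (V : zmodType) (rho : R -> V -> V) : Prop := {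
  act1 : forall x, rho 1 x = x;
  actM : forall a b x, rho (a * b) x = rho a (rho b x);
  actDr : forall a x y, rho a (x + y) = rho a x + rho a y;
  actDl : forall x a b, rho (a + b) x = rho a x + rho b x }.

Lemma poly_action (R : comNzRingType) (V : zmodType) (rho : R -> V -> V) (T : V -> V) :
  is_action rho -> (forall x y, T (x + y) = T x + T y) ->
  (forall a x, rho a (T x) = T (rho a x)) ->
  exists rho' : {poly R} -> V -> V, [/\ is_action rho',
    forall a x, rho' a%:P x = rho a x, forall x, rho' 'X x = T x,
    forall U : set V, is_zsub U -> (forall a x, U x -> U (rho a x)) ->
      (forall x, U x -> U (T x)) -> forall p x, U x -> U (rho' p x) &
    forall u : V -> V, (forall x y, u (x + y) = u x + u y) ->
      (forall a x, u (rho a x) = rho a (u x)) -> (forall x, u (T x) = T (u x)) ->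
      forall p x, u (rho' p x) = rho' p (u x)].
Proof.
move=> hrho TD Trho.
have rho0r a : rho a 0 = 0 by apply: (addrI (rho a 0)); rewrite -(actDr hrho) !addr0.
have rho0l x : rho 0 x = 0 by apply: (addrI (rho 0 x)); rewrite -(actDl hrho) !addr0.
have T0 : T 0 = 0 by apply: (addrI (T 0)); rewrite -TD !addr0.
pose rho' (p : {poly R}) x := \sum_(i < size p) rho p`_i (iter i T x).
have rho'E (p : {poly R}) x n : (size p <= n)%N -> rho' p x = \sum_(i < n) rho p`_i (iter i T x).
  move=> pn; rewrite /rho' (big_ord_widen n (fun i => rho p`_i (iter i T x)))// big_mkcond.
  apply: eq_bigr => i _; case: ltnP => // /(nth_default 0) ->; by rewrite rho0l.
have TiD n x y : iter n T (x + y) = iter n T x + iter n T y.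
  by elim: n => // n IH; rewrite !iterS IH TD.
have rho'Dr p x y : rho' p (x + y) = rho' p x + rho' p y.
  by rewrite -big_split; apply: eq_bigr => i _; rewrite TiD (actDr hrho).
have rho'Dl x p q : rho' (p + q) x = rho' p x + rho' q x.
  pose n := maxn (size p) (size q).
  rewrite (rho'E _ _ n) ?size_polyD// (rho'E p _ n) ?leq_maxl//.
  rewrite (rho'E q _ n) ?leq_maxr// -big_split; apply: eq_bigr => i _.
  by rewrite coefD (actDl hrho).
have rho'C a x : rho' a%:P x = rho a x.
  by rewrite (rho'E _ _ 1%N) ?size_polyC_leq1// big_ord1 coefC.
have rho'u (u : V -> V) : (forall x y, u (x + y) = u x + u y) ->
      (forall a x, u (rho a x) = rho a (u x)) -> (forall x, u (T x) = T (u x)) ->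
      forall p x, u (rho' p x) = rho' p (u x).
  move=> uD urho uT p x.
  have u0 : u 0 = 0 by apply: (addrI (u 0)); rewrite -uD !addr0.
  rewrite /rho' (big_morph u uD u0); apply: eq_bigr => i _; rewrite urho; congr rho.
  by elim: (nat_of_ord i) => // n IH; rewrite !iterS uT IH.
have rho'X p x : rho' (p * 'X) x = rho' p (T x).
  rewrite (rho'E _ _ (size p).+1); last first.
    by rewrite (leq_trans (size_polyMleq _ _))// size_polyX addn2.
  rewrite big_ord_recl coefMX /= rho0l add0r; apply: eq_bigr => i _.
  by rewrite coefMX /= -iterSr.
have rho'T p x : T (rho' p x) = rho' p (T x) by apply: rho'u.
have rho'rho a p x : rho a (rho' p x) = rho' p (rho a x).
  apply: rho'u => //; first exact: (actDr hrho).
  by move=> b y; rewrite -!(actM hrho) mulrC.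
exists rho'; split=> //.
- split=> // [x|p q x]; first by rewrite rho'C (act1 hrho).

  elim/poly_ind: p x => [|p c IH] x; first by rewrite mul0r -polyC0 !rho'C !rho0l.
  rewrite mulrDl !rho'Dl mulrAC !rho'X IH rho'T; congr (_ + _).
  rewrite mul_polyC rho'C (rho'E _ _ (size q)) ?size_scale_leq//.
  rewrite [in RHS]/rho' (big_morph (rho c) (actDr hrho c) (rho0r c)).
  by apply: eq_bigr => i _; rewrite coefZ (actM hrho).
- by move=> x; rewrite -['X]mul1r rho'X rho'C (act1 hrho).
- move=> U hU Urho UT p x Ux; rewrite /rho'; apply: (big_ind U) => [||i _].
  + exact: zsub0.
  + exact: zsubD.
  + by apply: Urho; elim: (i : nat) => // n IH; rewrite iterS; apply: UT.
Qed.

(** Commuting additive operators make an abelian group a module over integer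
polynomials.  The last clause, on operators commuting with the given ones, is
what allows the next variable to be added. *)
Lemma Zpoly_action (d : nat) (V : zmodType) (t : nat -> V -> V) :
  (forall i x y, t i (x + y) = t i x + t i y) ->
  (forall i j x, t i (t j x) = t j (t i x)) ->
  exists rho : Zpoly d -> V -> V, [/\ is_action rho,
    forall i, (i < d)%N -> exists r, forall x, rho r x = t i x,
    forall U : set V, is_zsub U -> (forall i x, U x -> U (t i x)) ->
      forall r x, U x -> U (rho r x) &
    forall u : V -> V, (forall x y, u (x + y) = u x + u y) ->
      (forall i x, u (t i x) = t i (u x)) ->
      forall p x, u (rho p x) = rho p (u x)].
Proof.
move=> tD tC; elim: d => [|d [rho [hrho rt rhoU rhou]]].
  exists (fun a x => x *~ a); split=> // [|U hU _ r x Ux|u uD _ p x].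
    split=> [x|a b x|a x y|x a b]; first by [].
    - by rewrite mulrC mulrzA.
    - exact: mulrzDl.
    - exact: mulrzDr.
    by case: r => n; rewrite ?NegzE ?mulrNz -?pmulrn; [|apply: (zsubN hU)]; apply: zsubMn.
  have u0 : u 0 = 0 by apply: (addrI (u 0)); rewrite -uD !addr0.
  have uN y : u (- y) = - u y by apply: (addrI (u y)); rewrite -uD !subrr.
  have un n : u (x *+ n) = u x *+ n by elim: n => // n IH; rewrite !mulrS uD IH.
  by case: p => n; rewrite /= ?NegzE -?pmulrn ?mulrNz -?pmulrn ?uN un.
have [rho' [hrho' rC rX rU ru]] := poly_action hrho (tD d)
  (fun a x => esym (rhou (t d) (tD d) (fun i x => tC d i x) a x)).
exists rho'; split=> // [i|U hU Ut|u uD ut p x].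
  rewrite ltnS leq_eqVlt => /orP[/eqP->|/rt[r hr]]; first by exists 'X.
  by exists r%:P => x; rewrite rC.
  by apply: rU => // [a x|x]; [exact: rhoU|exact: Ut].
by apply: ru => // a y; apply: rhou.
Qed.

Section ActType.
Variables (R : comNzRingType) (V : zmodType) (rho : R -> V -> V).

(** The module structure is attached to the proof [h], so that it can be inferred
from the type. *)
Definition act_type (h : is_action rho) : Type := V.

Variable h : is_action rho.

HB.instance Definition _ := GRing.Zmodule.on (act_type h).
HB.instance Definition _ := GRing.Zmodule_isLmodule.Build R (act_type h)
  (fun a b v => esym (actM h a b v)) (act1 h) (actDr h) (actDl h).

End ActType.
End Action.

(** * Subgroups, commutators and quotients *)

Section Subgroups.
Local Open Scope group_scope.
Local Open Scope classical_set_scope.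
Implicit Types T U : groupType.

Record is_subg T (S : set T) : Prop := {
  subg1 : S 1;
  subgM : forall x y, S x -> S y -> S (x * y);
  subgV : forall x, S x -> S x^-1 }.

Definition conj_closed T (S : set T) := forall x g, S x -> S (x ^ g).

Definition is_normal T (S : set T) := is_subg S /\ conj_closed S.

Definition is_hom T U (f : T -> U) := forall x y, f (x * y) = f x * f y.

Definition gen T (A : set T) (x : T) : Prop :=
  forall S, is_subg S -> A `<=` S -> S x.

Definition com T (A B : set T) : set T :=
  gen [set z | exists a b, [/\ A a, B b & z = [~ a, b]]].

Section Basics.
Variable T : groupType.
Implicit Types (A B S X : set T) (x y g : T).

Lemma subgX S x n : is_subg S -> S x -> S (x ^+ n).
Proof.
move=> hS Sx; elim: n => [|n IH]; first exact: subg1.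
by rewrite expgS; apply: subgM.
Qed.

Lemma subgMr S x y : is_subg S -> S y -> S (x * y) -> S x.
Proof. by move=> hS /(subgV hS) Sx h; have := subgM hS h Sx; rewrite mulgK. Qed.

Lemma subgJ S x y : is_subg S -> S x -> S y -> S (x ^ y).
Proof. by move=> hS Sx Sy; do !apply: subgM => //; apply: subgV. Qed.

Lemma subgR S x y : is_subg S -> S x -> S y -> S [~ x, y].
Proof. by move=> hS Sx Sy; apply: subgM => //; [apply: subgV|apply: subgJ]. Qed.

Lemma normalRl S x y : is_normal S -> S x -> S [~ x, y].
Proof. by move=> [hS hJ] Sx; apply: subgM => //; [apply: subgV|apply: hJ]. Qed.

Lemma normalRr S x y : is_normal S -> S y -> S [~ x, y].
Proof. by move=> hS Sy; rewrite -invgR; apply: subgV; [case: hS|apply: normalRl]. Qed.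

Lemma subgT : is_subg [set: T]. Proof. by []. Qed.
Lemma subgI A B : is_subg A -> is_subg B -> is_subg (A `&` B).
Proof.
move=> hA hB; split=> [|x y [? ?] [? ?]|x [? ?]]; split;
  by [apply: subg1|apply: subgM|apply: subgV].
Qed.

Lemma normalI A B : is_normal A -> is_normal B -> is_normal (A `&` B).
Proof.
move=> [hA jA] [hB jB]; split; first exact: subgI.
by move=> x g [? ?]; split; [apply: jA|apply: jB].
Qed.

Lemma gen_subg A : is_subg (gen A).
Proof.
split=> [S hS _|x y hx hy S hS AS|x hx S hS AS]; first exact: subg1.
  by apply: subgM => //; [apply: hx|apply: hy].
by apply: subgV => //; apply: hx.
Qed.

Lemma com_subg A B : is_subg (com A B). Proof. exact: gen_subg. Qed.

Lemma mem_com A B a b : A a -> B b -> com A B [~ a, b].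
Proof. by move=> Aa Bb S hS; apply; exists a, b. Qed.

Lemma com_min A B S : is_subg S -> (forall a b, A a -> B b -> S [~ a, b]) ->
  com A B `<=` S.
Proof. by move=> hS h x /(_ S hS); apply=> _ [a [b [Aa Bb ->]]]; apply: h. Qed.

Lemma comS A B A' B' : A `<=` A' -> B `<=` B' -> com A B `<=` com A' B'.
Proof.
move=> AA BB; apply: com_min; first exact: com_subg.
by move=> a b Aa Bb; apply: mem_com; [apply: AA|apply: BB].
Qed.

Lemma com_normal A B : conj_closed A -> conj_closed B -> is_normal (com A B).
Proof.
move=> jA jB; split=> [|x g]; first exact: com_subg.
apply: (@com_min _ _ [set x | com A B (x ^ g)]).
  split=> /= [|u v hu hv|u hu].
  - by rewrite conj1g; apply: (subg1 (com_subg A B)).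
  - by rewrite conjMg; apply: (subgM (com_subg A B)).
  - by rewrite conjVg; apply: (subgV (com_subg A B)).
by move=> a b Aa Bb /=; rewrite conjRg; apply: mem_com; [apply: jA|apply: jB].
Qed.

Lemma com_subl A B : is_normal A -> com A B `<=` A.
Proof. by move=> hA; apply: com_min => [|a b Aa _]; [case: hA|apply: normalRl]. Qed.

Definition mulset A B : set T := [set z | exists a b, [/\ A a, B b & z = a * b]].

Lemma mulset_subg A B : is_subg A -> is_normal B -> is_subg (mulset A B).
Proof.
move=> hA [hB jB]; split.
- by exists 1, 1; rewrite mulg1; split=> //; [exact: subg1 hA|exact: subg1 hB].
- move=> _ _ [a [b [Aa Bb ->]]] [c [d [Ac Bd ->]]].
  exists (a * c), (b ^ c * d); split; first exact: subgM.
    by apply: subgM => //; apply: jB.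
  by rewrite !mulgA -(mulgA a b c) (conjgC b c) !mulgA.
- move=> _ [a [b [Aa Bb ->]]]; exists a^-1, (b^-1 ^ a^-1); split.
  + exact: subgV. + by apply: jB; apply: subgV.
  + by rewrite invgM (conjgC b^-1).
Qed.

Lemma mulset_normal A B : is_normal A -> is_normal B -> is_normal (mulset A B).
Proof.
move=> [hA jA] hB; split; first exact: mulset_subg.
move=> _ g [a [b [Aa Bb ->]]]; exists (a ^ g), (b ^ g); rewrite conjMg; split=> //.
  exact: jA. by case: hB => _; apply.
Qed.

Lemma mulsetl A B : is_subg B -> A `<=` mulset A B.
Proof. by move=> hB a Aa; exists a, 1; rewrite mulg1; split=> //; apply: subg1. Qed.

Lemma mulsetr A B : is_subg A -> B `<=` mulset A B.
Proof. by move=> hA b Bb; exists 1, b; rewrite mul1g; split=> //; apply: subg1. Qed.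

End Basics.

Section Hom.
Variables (T U : groupType) (f : T -> U).
Hypothesis fM : is_hom f.

Lemma hom1 : f 1 = 1.
Proof. by apply: (mulIg (f 1)); rewrite -fM !mul1g. Qed.

Lemma homV x : f x^-1 = (f x)^-1.
Proof. by apply: (mulIg (f x)); rewrite -fM !mulVg hom1. Qed.

Lemma homJ x y : f (x ^ y) = f x ^ f y.
Proof. by rewrite /conjg !fM homV. Qed.

Lemma homR x y : f [~ x, y] = [~ f x, f y].
Proof. by rewrite /commg fM homV homJ. Qed.

Lemma homX x n : f (x ^+ n) = f x ^+ n.
Proof. by elim: n => [|n IH]; rewrite ?hom1// !expgS fM IH. Qed.

Lemma preim_subg (S : set U) : is_subg S -> is_subg (f @^-1` S).
Proof.
move=> hS; split=> /= [|x y|x]; rewrite /preimage /=.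
- by rewrite hom1; apply: subg1.
- by rewrite fM; apply: subgM.
- by rewrite homV; apply: subgV.
Qed.

Lemma preim_normal (S : set U) : is_normal S -> is_normal (f @^-1` S).
Proof.
move=> [hS jS]; split; first exact: preim_subg.
by move=> x g; rewrite /preimage /= homJ; apply: jS.
Qed.

Lemma im_subg (S : set T) : is_subg S -> is_subg (f @` S).
Proof.
move=> hS; split.
- by exists 1; [apply: subg1|rewrite hom1].
- by move=> _ _ [x Sx <-] [y Sy <-]; exists (x * y); [apply: subgM|rewrite fM].
- by move=> _ [x Sx <-]; exists x^-1; [apply: subgV|rewrite homV].
Qed.

Lemma im_com (A B : set T) : f @` com A B = com (f @` A) (f @` B).
Proof.
apply/seteqP; split=> [_ [x hx <-]|].
  apply: (hx (f @^-1` com (f @` A) (f @` B))); first exact/preim_subg/com_subg.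
  by move=> _ [a [b [Aa Bb ->]]]; rewrite /preimage /= homR; apply: mem_com; [exists a|exists b].
apply: com_min; first exact/im_subg/com_subg.
by move=> _ _ [a Aa <-] [b Bb <-]; exists [~ a, b]; [apply: mem_com|rewrite homR].
Qed.

End Hom.

Section SubPred.
Variables (T : groupType) (S : set T).
Definition sset_pred (h : is_subg S) : {pred T} := fun x => `[< S x >].
Variable h : is_subg S.
Fact sset_predM : mulg_closed (sset_pred h).
Proof. by move=> x y /asboolP Sx /asboolP Sy; apply/asboolP/(subgM h). Qed.
Fact sset_pred1 : 1 \in sset_pred h.
Proof. exact/asboolP/(subg1 h). Qed.
Fact sset_predV : invg_closed (sset_pred h).
Proof. by move=> x /asboolP Sx; apply/asboolP/(subgV h). Qed.
HB.instance Definition _ := isMulClosed.Build T (sset_pred h) sset_predM.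
HB.instance Definition _ := isMul1Closed.Build T (sset_pred h) sset_pred1.
HB.instance Definition _ := isInvClosed.Build T (sset_pred h) sset_predV.
Definition sset : groupClosed T := GroupClosed.clone T (sset_pred h) _.
Lemma ssetP x : reflect (S x) (x \in sset).
Proof. exact: asboolP. Qed.
End SubPred.

Section SetPred.
Variables (T : groupType) (S : set T).
Definition nset_pred (h : is_normal S) : {pred T} := fun x => `[< S x >].
Variable h : is_normal S.
Fact nset_predM : mulg_closed (nset_pred h).
Proof. by move=> x y /asboolP Sx /asboolP Sy; apply/asboolP/(subgM h.1). Qed.
Fact nset_pred1 : 1 \in nset_pred h.
Proof. exact/asboolP/(subg1 h.1). Qed.
Fact nset_predV : invg_closed (nset_pred h).
Proof. by move=> x /asboolP Sx; apply/asboolP/(subgV h.1). Qed.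
Fact nset_predJ x g : x \in nset_pred h -> x ^ g \in nset_pred h.
Proof. by move=> /asboolP Sx; apply/asboolP/(h.2). Qed.
HB.instance Definition _ := isMulClosed.Build T (nset_pred h) nset_predM.
HB.instance Definition _ := isMul1Closed.Build T (nset_pred h) nset_pred1.
HB.instance Definition _ := isInvClosed.Build T (nset_pred h) nset_predV.
HB.instance Definition _ := isNormalClosed.Build T (nset_pred h) nset_predJ.
Definition nset : normalClosed T := NormalClosed.clone T (nset_pred h) _.
Lemma nsetP x : reflect (S x) (x \in nset).
Proof. exact: asboolP. Qed.
End SetPred.

Lemma quotient_exists T (X : set T) : is_normal X ->
  exists (Q : groupType) (pi : T -> Q), [/\ is_hom pi,
    forall x, pi x = 1 <-> X x & forall q, exists x, pi x = q].
Proof.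
move=> hX; exists (quotg (nset hX)), (fun x => (\pi_(quotg (nset hX)) x)%qT); split.
- by move=> x y; rewrite -quotg_mulE.
- move=> x; split=> [/esym/quotg_eqP|Xx].
    by rewrite /eqmodg invg1 mul1g => /nsetP.
  by apply/esym/quotg_eqP; rewrite /eqmodg invg1 mul1g; apply/nsetP.
- by elim/quotW => x; exists x.
Qed.

Section AbType.
Variables (Q : groupType) (Y : set Q).
(** A commutative subgroup [Y] of [Q], rewritten additively to have integer multiples
and modules at hand. *)
Definition ab_axiom := is_subg Y /\ forall x y, Y x -> Y y -> x * y = y * x.
Definition ab_type (h : ab_axiom) : Type := {q : Q | `[< Y q >]}.
Variable h : ab_axiom.
HB.instance Definition _ := Choice.on (ab_type h).
Let A := ab_type h.
Definition ab_mk q (Yq : Y q) : A := exist _ q (asboolT Yq).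
Definition ab_val (u : A) : Q := sval u.
Lemma ab_valP (u : A) : Y (ab_val u). Proof. exact/asboolP/(svalP u). Qed.
Lemma ab_val_inj : injective ab_val. Proof. exact: val_inj. Qed.
Definition ab_add (u v : A) : A := ab_mk (subgM h.1 (ab_valP u) (ab_valP v)).
Definition ab_opp (u : A) : A := ab_mk (subgV h.1 (ab_valP u)).
Definition ab_zero : A := ab_mk (subg1 h.1).
Fact ab_addA : associative ab_add.
Proof. by move=> u v w; apply: ab_val_inj; rewrite /= mulgA. Qed.
Fact ab_addC : commutative ab_add.
Proof. by move=> u v; apply: ab_val_inj; rewrite /= h.2//; apply: ab_valP. Qed.
Fact ab_add0 : left_id ab_zero ab_add.
Proof. by move=> u; apply: ab_val_inj; rewrite /= mul1g. Qed.
Fact ab_addN : left_inverse ab_zero ab_opp ab_add.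
Proof. by move=> u; apply: ab_val_inj; rewrite /= mulVg. Qed.
HB.instance Definition _ := GRing.isZmodule.Build (ab_type h)
  ab_addA ab_addC ab_add0 ab_addN.
End AbType.

(** An abelian section [Y / X], presented by a map on the whole group that is
meaningful on [Y]; this spares the type of elements of [Y]. *)
Lemma abelian_quotient_exists T (Y X : set T) : is_subg Y -> is_normal X ->
  com Y Y `<=` X ->
  exists (V : zmodType) (p : T -> V), [/\
    forall x y, Y x -> Y y -> p (x * y) = (p x + p y)%R,
    forall x, Y x -> (p x = 0%R <-> X x) & forall v, exists2 x, Y x & p x = v].
Proof.
move=> hY hX YX; have [Q [pi [piM piK pis]]] := quotient_exists hX.
have h : ab_axiom (pi @` Y).
  split=> [|_ _ [x Yx <-] [y Yy <-]]; first exact: im_subg.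
  apply/eqP; rewrite -!piM -divg_eq1 -(homV piM) -piM; apply/eqP/piK.
  rewrite invgM; have -> : x * y * (x^-1 * y^-1) = [~ x^-1, y^-1].
    by rewrite /commg /conjg !gnorm.
  by apply: YX; apply: mem_com; exact: (subgV hY).
exists (ab_type h).
exists (fun x => if pselect ((pi @` Y) (pi x)) is left Yx then ab_mk h Yx else 0%R).
split.
- move=> x y Yx Yy; case: pselect => [Yxy|[]]; last by exists (x * y) => //; apply: subgM.
  case: pselect => [Yx'|[]]; last by exists x.
  case: pselect => [Yy'|[]]; last by exists y.
  by apply: ab_val_inj; rewrite /= piM.
- move=> x Yx; case: pselect => [Yx'|[]]; last by exists x.
  rewrite -piK; split=> [/(congr1 (@ab_val _ _ h))//|pix].
  exact: ab_val_inj.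
- move=> v; have [y Yy yv] := ab_valP v; exists y => //.
  case: pselect => [Yx'|[]]; last by exists y.
  by apply: ab_val_inj; rewrite /= yv.
Qed.

End Subgroups.

(** * Subgroups of bounded index *)

Section Index.
Local Open Scope group_scope.
Local Open Scope classical_set_scope.
Variable T : groupType.
Implicit Types (A B P S : set T) (x y g : T) (m n : nat).

(** An index bound is a labelling of the cosets by ['I_m]; this reduces finiteness
arguments to counting maps between finite types. *)
Definition index_le A P m := exists f : T -> 'I_m,
  forall x y, A x -> A y -> f x = f y -> P (x^-1 * y).

Definition has_index A P m := exists f : T -> 'I_m,
  (forall x y, A x -> A y -> f x = f y <-> P (x^-1 * y)) /\
  (forall i, exists2 x, A x & f x = i).

(** Each coset gets the least of its labels, which makes the labelling separate
exactly the cosets. *)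
Lemma coset_fun A P m : is_subg P -> index_le A P m ->
  exists f : T -> 'I_m, forall x y, A x -> A y -> f x = f y <-> P (x^-1 * y).
Proof.
move=> hP [f hf].
pose Q x (i : 'I_m) := `[< exists y, [/\ A y, f y = i & P (x^-1 * y)] >].
pose c x := odflt (f x) [pick i | Q x i].
have cP x : A x -> exists y, [/\ A y, f y = c x & P (x^-1 * y)].
  move=> Ax; rewrite /c; case: pickP => [i /asboolP//|/(_ (f x))/negbT/asboolP[]].
  by exists x; rewrite mulVg; split=> //; apply: subg1.
exists c => x y Ax Ay; split=> [cxy|Pxy].
  have [x' [Ax' fx' Px']] := cP x Ax; have [y' [Ay' fy' Py']] := cP y Ay.
  have : P (x'^-1 * y') by apply: hf => //; rewrite fx' fy'.
  move=> /(subgM hP Px'); rewrite mulgA mulgK => /subgM; move/(_ hP _ (subgV hP Py')).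
  by rewrite invgM invgK mulgA mulgK.
(* Elements of one coset admit the same labels, hence get the same least one. *)
suff QE : Q x =1 Q y.
  rewrite /c (eq_pick QE); case: pickP => // /(_ (f y))/negbT/asboolP[].
  by exists y; rewrite mulVg; split=> //; apply: subg1.
move=> i; apply/asboolP/asboolP => -[z [Az fz Pz]]; exists z; split=> //.
  have -> : y^-1 * z = (x^-1 * y)^-1 * (x^-1 * z) by rewrite invgM invgK mulgA mulgK.
  by apply: subgM => //; apply: subgV.
have -> : x^-1 * z = (x^-1 * y) * (y^-1 * z) by rewrite mulgA mulgK.
exact: subgM.
Qed.

Lemma index_leS A A' P P' m : A' `<=` A -> (P `<=` P') ->
  index_le A P m -> index_le A' P' m.
Proof. by move=> AA PP [f hf]; exists f => x y Ax Ay fxy; apply/PP/hf => //; apply: AA. Qed.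

Lemma index_le_fin A P (F : finType) (f : T -> F) :
  (forall x y, A x -> A y -> f x = f y -> P (x^-1 * y)) -> index_le A P #|F|.
Proof.
move=> hf; exists (fun x => enum_rank (f x)) => x y Ax Ay /enum_rank_inj; exact: hf.
Qed.

Definition fingen := exists s : seq T,
  forall H, is_subg H -> (forall x, x \in s -> H x) -> forall x, H x.

(** A finitely generated group has finitely many subgroups of index at most [m]: the
labelling of the cosets of such a subgroup is determined by the label of [1]
and by the self-maps of ['I_m] that generators induce.  So an arbitrary family
of them has an intersection of finite index. *)
Lemma bounded_index_bigcap (I : Type) (P : I -> set T) m : fingen ->
  (forall i, is_subg (P i)) -> (forall i, index_le [set: T] (P i) m) ->
  exists M, index_le [set: T] [set x | forall i, P i x] M.
Proof.
move=> [s0 hs0] hP hPm.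
pose s := s0 ++ map (fun x => x^-1) s0.
have hs (H : set T) : is_subg H -> (forall x, x \in s -> H x) -> forall x, H x.
  by move=> hH sH; apply: hs0 => // x xs; apply: sH; rewrite mem_cat xs.
have sV x : x \in s -> x^-1 \in s.
  rewrite !mem_cat => /orP[xs|/mapP[y ys ->]]; last by rewrite invgK ys.
  by rewrite (map_f (fun x => x^-1)) ?orbT.
pose Dt := ('I_m * {ffun 'I_(size s) -> {ffun 'I_m -> 'I_m}})%type.
pose data (f : T -> 'I_m) : Dt := (f 1, [ffun j : 'I_(size s) => [ffun a : 'I_m =>
   if pselect (exists x, f x = a) is left e then f (s`_j * projT1 (cid e)) else a]]).
have /choice[f hf] : forall i, exists f : T -> 'I_m, forall x y, f x = f y <-> P i (x^-1 * y).
  by move=> i; have [f hf] := coset_fun (hP i) (hPm i); exists f => x y; apply: hf.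
have fM i x y g : f i x = f i y -> f i (g * x) = f i (g * y).
  by move=> /hf h; apply/hf; rewrite invgM -mulgA mulKg.
have dataP i j : data (f i) = data (f j) -> f i =1 f j.
  move=> [f1 /ffunP fs].
  have step x w : x \in s -> f i w = f j w -> f i (x * w) = f j (x * w).
    move=> xs fw; have xsz : (index x s < size s)%N by rewrite index_mem.
    have /ffunP/(_ (f i w)) := fs (Ordinal xsz); rewrite !ffunE /= nth_index//.
    case: pselect => [e|[]]; last by exists w.
    case: pselect => [e'|[]]; last by exists w; rewrite fw.
    case: (cid e) => w1 /= fw1; case: (cid e') => w2 /= fw2.
    rewrite (fM _ _ _ _ fw1) => ->; apply: fM; by rewrite fw2.
  suff h x w : f i w = f j w <-> f i (x * w) = f j (x * w).
    by move=> x; rewrite -[x]mulg1; apply: (h x 1).1.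
  move: x w; apply: (hs [set x | forall w, f i w = f j w <-> f i (x * w) = f j (x * w)]).
    split=> /= [w|x y hx hy w|x hx w]; first by rewrite mul1g.
      by rewrite -mulgA; exact: iff_trans (hy w) (hx _).
    by have := hx (x^-1 * w); rewrite mulVKg; exact: iff_sym.
  move=> x xs w; split; first exact: step.
  by move=> /(step _ _ (sV _ xs)); rewrite mulKg.
(* One labelling is chosen for each possible value of the data; together they
   separate the cosets of the intersection. *)
pose c (x : T) : {ffun Dt -> option 'I_m} := [ffun t =>
   if pselect (exists i, data (f i) = t) is left e then Some (f (projT1 (cid e)) x) else None].
exists #|{ffun Dt -> option 'I_m}|; apply: (@index_le_fin _ _ _ c) => x y _ _ cxy i.
apply/hf; move/ffunP: cxy => /(_ (data (f i))); rewrite !ffunE.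
case: pselect => [e [] |[]]; last by exists i.
by case: (cid e) => j /= /dataP fji; rewrite !fji.
Qed.

(** The images of the [G k] in the finite set of cosets of [P] decrease, hence are
eventually constant. *)
Lemma chain_stabilises (G : nat -> set T) P m : index_le [set: T] P m ->
  (forall k, G k.+1 `<=` G k) ->
  exists L, forall l k, (L <= l <= k)%N -> forall g, G l g ->
    exists2 h, G k h & P (h^-1 * g).
Proof.
move=> [f hf] GS.
have Gmono l k : (l <= k)%N -> G k `<=` G l.
  by move=> /subnKC <-; elim: (k - l)%N => [|n IH]; rewrite ?addn0 ?addnS// => x /GS /IH.
pose D k := [set i : 'I_m | `[< exists2 x, G k x & f x = i >]]%SET.
have Dmono l k : (l <= k)%N -> (D k \subset D l)%SET.
  move=> lk; apply/fintype.subsetP => i; rewrite !finset.in_set => /asboolP[x Gx fx]; apply/asboolP.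
  by exists x => //; exact: Gmono lk _ Gx.
have exn : exists n, `[< exists k, #|D k| = n >] by exists #|D 0%N|; apply/asboolP; exists 0%N.
have [_ /asboolP[L <-] nmin] := ex_minnP exn.
exists L => l k /andP[Ll lk] g Gg.
have DE j : (L <= j)%N -> D j = D L.
  move=> Lj; apply/eqP; rewrite eqEcard Dmono//=; apply: nmin.
  by apply/asboolP; exists j.
have : f g \in D l by rewrite finset.in_set; apply/asboolP; exists g.
rewrite (DE _ Ll) -(DE _ (leq_trans Ll lk)) finset.in_set => /asboolP[h Gh fh].
by exists h => //; apply: hf.
Qed.

Definition actker A P : set T := [set g | forall x, A x -> P [~ x, g]].

Lemma actker_subg A P : is_normal A -> is_normal P -> is_subg (actker A P).
Proof.
move=> [hA jA] [hP jP]; split=> [x Ax|g h hg hh x Ax|g hg x Ax].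
- by rewrite commg1; apply: subg1.
- have -> : [~ x, g * h] = [~ x, h] * [~ x, g] ^ h by rewrite /commg /conjg !gnorm.
  by apply: subgM => //; [apply: hh|apply/jP/hg].
- have -> : [~ x, g^-1] = [~ x ^ g^-1, g]^-1 by rewrite /commg /conjg !gnorm.
  by apply: subgV => //; apply/hg/jA.
Qed.


(** An element acts on the section [A / P] by a self-map of its at most [m]
cosets. *)
Lemma actker_index A P m : is_normal A -> is_normal P -> index_le A P m ->
  index_le [set: T] (actker A P) #|{ffun 'I_m -> option 'I_m}|.
Proof.
move=> [hA jA] [hP jP] Am; have [c hc] := coset_fun hP Am.
pose F g : {ffun 'I_m -> option 'I_m} := [ffun i =>
  if pselect (exists2 x, A x & c x = i) is left e then Some (c (projT1 (cid2 e) ^ g)) else None].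
apply: (@index_le_fin _ _ _ F) => g g' _ _ /ffunP Fgg x Ax.
have key y : A y -> P ((y ^ g)^-1 * y ^ g').
  move=> Ay; have := Fgg (c y); rewrite !ffunE; case: pselect => [e [] |[]]; last by exists y.
  case: (cid2 e) => z Az cz /= h.
  have Pzy : P (z^-1 * y) by apply/hc.
  have Pz : P ((z ^ g)^-1 * z ^ g') by apply/hc => //; apply: jA.
  have -> : (y ^ g)^-1 * y ^ g' = (z^-1 * y)^-1 ^ g * (((z ^ g)^-1 * z ^ g') * (z^-1 * y) ^ g').
    by rewrite /conjg !gnorm.
  apply: (subgM hP); first by apply: jP; apply: subgV.
  by apply: (subgM hP) => //; apply: jP.
have := key _ (jA _ g^-1 Ax).
suff -> : ((x ^ g^-1) ^ g)^-1 * (x ^ g^-1) ^ g' = [~ x, g^-1 * g'] by [].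
by rewrite /commg /conjg !gnorm.
Qed.

(** For [l] large, an element of [G l] acts on every section [A i / P i] as some
element of [G k] does.  The bound [m] on the orders of the sections has to be
uniform in [i]; in the applications [i] involves [k], which is arbitrarily
large. *)
Lemma action_stabilises (G : nat -> set T) (I : Type) (A P : I -> set T) m : fingen ->
  (forall k, G k.+1 `<=` G k) ->
  (forall i, is_normal (A i)) -> (forall i, is_normal (P i)) ->
  (forall i, index_le (A i) (P i) m) ->
  exists L, forall l k, (L <= l <= k)%N -> forall g, G l g ->
    exists2 h, G k h & forall i x, A i x -> P i [~ x, h^-1 * g].
Proof.
move=> Tfg GS hA hP hAP.
have [M hM] := bounded_index_bigcap Tfg (fun i => actker_subg (hA i) (hP i))
  (fun i => actker_index (hA i) (hP i) (hAP i)).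
have [L hL] := chain_stabilises hM GS; exists L => l k lk g Gg.
by have [h Gh hh] := hL l k lk g Gg; exists h => // i x; apply: hh.
Qed.

End Index.

(** * Self-covers have solvable quotients *)

Section Solvable.
Local Open Scope group_scope.
Local Open Scope classical_set_scope.

Section ExactIndex.
Variable T : groupType.
Implicit Types (A B P S : set T) (m n : nat).

Lemma has_index_exists A P m : is_subg A -> is_subg P -> index_le A P m ->
  exists n, has_index A P n.
Proof.
move=> hA hP /(coset_fun hP)[f hf].
pose D := finset (fun i => `[< exists2 x, A x & f x = i >]).
have D1 : f 1 \in D by rewrite finset.in_set; apply/asboolP; exists 1 => //; apply: subg1.
have fD x : A x -> f x \in D by move=> Ax; rewrite finset.in_set; apply/asboolP; exists x.
exists #|D|, (fun x => enum_rank_in D1 (f x)); split=> [x y Ax Ay|i].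
  rewrite -hf//; split=> [|-> //]; apply: enum_rank_in_inj; exact: fD.
have := enum_valP i; rewrite finset.in_set => /asboolP[x Ax fx].
by exists x => //; rewrite fx enum_valK_in.
Qed.

Lemma has_index_leq A P m n : has_index A P m -> has_index A P n -> (m <= n)%N.
Proof.
move=> [f [hf fs]] [g [hg _]].
have /choice[r hr] : forall i, exists x, A x /\ f x = i.
  by move=> i; have [x Ax fx] := fs i; exists x.
rewrite -[m]card_ord -[n]card_ord; apply: (@leq_card _ _ (fun i => g (r i))) => i j.
have [Ai fi] := hr i; have [Aj fj] := hr j.
by move=> /(hg _ _ Ai Aj)/(hf _ _ Ai Aj); rewrite fi fj.
Qed.

Lemma has_index_uniq A P m n : has_index A P m -> has_index A P n -> m = n.
Proof. by move=> h1 h2; apply/eqP; rewrite eqn_leq !(has_index_leq h1 h2, has_index_leq h2 h1). Qed.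

Lemma has_indexM A B P m n : is_subg A -> is_subg B -> is_subg P ->
  B `<=` A -> P `<=` B ->
  has_index A B m -> has_index B P n -> has_index A P (m * n).
Proof.
move=> hA hB hP BA PB [f [hf fs]] [g [hg gs]].
have /choice[r hr] : forall i, exists x, A x /\ f x = i.
  by move=> i; have [x Ax fx] := fs i; exists x.
have hr' x : A x -> B ((r (f x))^-1 * x).
  by move=> Ax; apply/hf => //; have [] := hr (f x).
pose h x : 'I_m * 'I_n := (f x, g ((r (f x))^-1 * x)).
have E x y z : (z^-1 * x)^-1 * (z^-1 * y) = x^-1 * y :> T by rewrite !gnorm.
suff [hh hs] : (forall x y, A x -> A y -> h x = h y <-> P (x^-1 * y)) /\
    (forall i, exists2 x, A x & h x = i).
  have c : #|{: 'I_m * 'I_n}| = (m * n)%N by rewrite card_prod !card_ord.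
  rewrite -c; exists (fun x => enum_rank (h x)); split=> [x y Ax Ay|i].
    by rewrite -hh//; split=> [/enum_rank_inj|->].
  by have [x Ax hx] := hs (enum_val i); exists x => //; rewrite hx enum_valK.
split=> [x y Ax Ay|[i j]].
  rewrite /h; split=> [[fxy]|Pxy].
    by rewrite -fxy => /hg; rewrite E; apply; [apply: hr'|rewrite fxy; apply: hr'].
  have fxy : f x = f y by apply/hf => //; apply: PB.
  congr pair => //; apply/hg; rewrite -?fxy ?E//; first exact: hr'.
  by rewrite fxy; apply: hr'.
have [Ai fi] := hr i; have [y By gy] := gs j.
have fry : f (r i * y) = i.
  by rewrite -[RHS]fi; apply/hf => //; [apply: subgM => //; apply: BA|
    rewrite invgM mulgVK; apply: subgV].
exists (r i * y); first by apply: subgM => //; apply: BA.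
by rewrite /h fry mulKg gy.
Qed.

End ExactIndex.

Fixpoint der (T : groupType) (j : nat) (A : set T) : set T :=
  if j is i.+1 then com (der i A) (der i A) else A.

Definition solv (T : groupType) (A P : set T) := exists j, der j A `<=` P.

Section Der.
Variable T : groupType.
Implicit Types (A B P S K X : set T).

Lemma derD i j A : der (i + j) A = der i (der j A).
Proof. by elim: i => //= i ->. Qed.

Lemma derS (U : groupType) (A B : set U) j : A `<=` B -> der j A `<=` der j B.
Proof. by move=> AB; elim: j => //= j IH; apply: comS. Qed.

Lemma im_der (U : groupType) (f : T -> U) j A : is_hom f -> f @` der j A = der j (f @` A).
Proof. by move=> fM; elim: j => //= j IH; rewrite (im_com fM) IH. Qed.

(** In the quotient by [S] the groups [A] and [B] satisfy [A <= B]. *)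
Lemma der_mod i S A B : is_normal S -> A `<=` mulset S B -> der i A `<=` mulset S (der i B).
Proof.
move=> hS AB; have [Q [pi [piM piK _]]] := quotient_exists hS.
have piAB : pi @` A `<=` pi @` B.
  move=> _ [x /AB[s [b [Ss Bb ->]]] <-]; exists b => //.
  by rewrite piM ((piK s).2 Ss) mul1g.
have dpi := derS (j := i) piAB; rewrite -!(im_der _ _ piM) in dpi.
move=> x dx; have : (pi @` der i B) (pi x) by apply: dpi; exists x.
move=> [b db pib]; exists (x * b^-1), b; split=> //; last by rewrite mulgVK.
by apply/piK; rewrite piM (homV piM) pib mulgV.
Qed.

Lemma solv_trans A B P : solv A B -> solv B P -> solv A P.
Proof.
move=> [i AB] [j BP]; exists (j + i)%N; rewrite derD.
by apply: subset_trans BP; apply: derS.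
Qed.

Definition rad K (x : T) := exists S, [/\ is_normal S, S x & solv S K].

(** A normal subgroup that is solvable modulo [K] and meets as many cosets of [K]
as possible absorbs all the others, since the product of two such subgroups is
again one. *)
Lemma rad_normal_solv K m : is_normal K -> index_le [set: T] K m ->
  is_normal (rad K) /\ solv (rad K) K.
Proof.
move=> hK [f hf].
pose D (S : set T) := finset (fun i => `[< exists2 x, S x & f x = i >]).
pose Pn n := `[< exists S, [/\ is_normal S, K `<=` S, solv S K & #|D S| = n] >].
have Pex : exists n, Pn n by exists #|D K|; apply/asboolP; exists K; split=> //; exists 0%N.
have Pm n : Pn n -> (n <= m)%N.
  by move=> /asboolP[S [_ _ _ <-]]; rewrite (leq_trans (max_card _))// card_ord.
have [_ /asboolP[S [hS KS Ssolv <-]] Smax] := ex_maxnP Pex Pm.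
suff -> : rad K = S by [].
apply/seteqP; split=> [x [S' [hS' S'x [i S'K]]]|x Sx]; last by exists S.
pose S2 := mulset S S'.
have hS2 : is_normal S2 by apply: mulset_normal.
have SS2 : S `<=` S2 by apply: mulsetl; case: hS'.
have DS : D S = D S2.
  apply/eqP; rewrite eqEcard; apply/andP; split.
    apply/fintype.subsetP => j; rewrite !finset.in_set => /asboolP[y Sy fy].
    by apply/asboolP; exists y => //; apply: SS2.
  apply: Smax; apply/asboolP; exists S2; split=> //.
    exact: subset_trans SS2.
  apply: solv_trans Ssolv; exists i.
  move=> y /(der_mod hS (@subset_refl _ _))[s [k [Ss /S'K Kk ->]]].
  by apply: (subgM hS.1) => //; apply: KS.
have : f x \in D S2.
  by rewrite finset.in_set; apply/asboolP; exists x => //; apply: (mulsetr hS.1).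
rewrite -DS finset.in_set => /asboolP[y Sy fyx].
have /KS Syx : K (y^-1 * x) by apply: hf.
by have := subgM hS.1 Sy Syx; rewrite mulVKg.
Qed.

End Der.

(** A normal subgroup of finite index isomorphic to the whole group, given by the
isomorphism rather than by the subgroup. *)
Record self_cover (T : groupType) (psi : T -> T) : Prop := {
  cover_hom : is_hom psi;
  cover_inj : injective psi;
  cover_normal : is_normal (range psi);
  cover_index : exists m, index_le [set: T] (range psi) m }.

(** Conjugation by [g] restricts to the normal subgroup [range psi]; [al] is the
automorphism of [T] that corresponds to it. *)
Lemma cover_conj (T : groupType) (psi : T -> T) g : self_cover psi ->
  exists al : T -> T, [/\ is_hom al, forall y, exists x, al x = y &
    forall x, psi (al x) = psi x ^ g].
Proof.
move=> [psiM psiI [_ psiJ] _].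
have /choice[be hbe] : forall h, exists al : T -> T, forall x, psi (al x) = psi x ^ h.
  move=> h; have /choice[al hal] : forall x, exists y, psi y = psi x ^ h.
    by move=> x; have [y _ <-] := psiJ (psi x) h (imageT psi x); exists y.
  by exists al.
exists (be g); split=> [x y|y|x]; last exact: hbe.
  by apply: psiI; rewrite psiM !hbe psiM conjMg.
by exists (be g^-1 y); apply: psiI; rewrite !hbe conjgKV.
Qed.

(** Let [N] be the range of [psi], of index [q], let [K] be the intersection of the
normal subgroups of index at most some [m], and let [X / K] be the solvable
radical of [T / K].  Then [psi X] is normal in [T] and contained in [X], and
computing the index of [psi X] through [N] and through [X] shows that it has
index [q] in [X].  If [m] is large enough with respect to [q], then [K]
centralises [X / psi X], so that [X / psi X] is solvable.  Hence the preimage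
of [X] under [psi] is solvable modulo [K], that is, contained in [X]: the
intersection of [X] and [N] is [psi X].  So [X / psi X] embeds in [T / N], and
both have order [q]: thus [T / N] is isomorphic to [X / psi X]. *)
Lemma self_cover_solvable (T : groupType) (psi : T -> T) : fingen T ->
  self_cover psi -> solv [set: T] (range psi).
Proof.
move=> Tfg hpsi; have [psiM psiI hN [m0 Nm0]] := hpsi.
have [q Nq] := has_index_exists (subgT T) hN.1 Nm0.
(* The bound of [actker_index] for a section of order [q]. *)
pose m := #|{ffun 'I_q -> option 'I_q}|.
pose K : set T := [set x | forall S, is_normal S -> index_le [set: T] S m -> S x].
have hK : is_normal K.
  split=> [|x g Kx S hS Sm]; last by apply: hS.2; apply: Kx.
  split=> [S hS _|x y Kx Ky S hS Sm|x Kx S hS Sm]; have [hS1 _] := hS.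
  - exact: subg1.
  - by apply: subgM => //; [apply: Kx|apply: Ky].
  - by apply: subgV => //; apply: Kx.
have [M KM] : exists M, index_le [set: T] K M.
  have [||M hM] := @bounded_index_bigcap T {S : set T | is_normal S /\ index_le [set: T] S m}
    (fun S => sval S) m Tfg.
  - by move=> [S [[? ?] ?]].
  - by move=> [S [? ?]].
  exists M; apply: index_leS hM => // x Kx S hS Sm.
  exact: (Kx (exist _ S (conj hS Sm))).
have Kinv (al : T -> T) : is_hom al -> forall x, K x -> K (al x).
  move=> alM x Kx S hS [f hf]; apply: (Kx (al @^-1` S)); first exact: preim_normal.
  exists (fun x => f (al x)) => y z _ _ /hf.
  by rewrite /preimage /= alM (homV alM); apply.
pose X := rad K; have [hX [j Xj]] := rad_normal_solv hK KM.
have hY : is_normal (psi @` X).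
  split=> [|_ g [x [S [hS Sx [i SK]]] <-]]; first exact: im_subg hX.1.
  have [al [alM als alE]] := cover_conj g hpsi.
  exists (al x); last exact: alE.
  exists (al @` S); split; last 2 first.
  - by exists x.
  - exists i; rewrite -(im_der _ _ alM) => _ [y /SK Ky <-]; exact: Kinv.
  split=> [|_ h [y Sy <-]]; first exact: im_subg hS.1.
  have [h' <-] := als h; exists (y ^ h'); first exact: hS.2.
  exact: homJ.
have YX : psi @` X `<=` X.
  move=> y Yy; exists (psi @` X); split=> //; exists j.
  by rewrite -(im_der _ _ psiM) => _ [x /Xj Kx <-]; apply: Kinv.
have YN : psi @` X `<=` range psi by move=> _ [x _ <-]; exists x.
have [a Xa] : exists a, has_index [set: T] X a.
  apply: has_index_exists (subgT T) hX.1 _; apply: index_leS KM => // x Kx.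
  by exists K; split=> //; exists 0%N.
have NYa : has_index (range psi) (psi @` X) a.
  have [f [hf fs]] := Xa.
  have /choice[g hg] : forall y, exists x, range psi y -> psi x = y.
    by move=> y; have [[x _ <-]|] := pselect (range psi y); [exists x|exists 1].
  have gpsi x : g (psi x) = x by apply: psiI; apply: hg; exists x.
  exists (fun y => f (g y)); split=> [_ _ [x _ <-] [y _ <-]|i].
    rewrite !gpsi hf// -(homV psiM) -psiM; split=> [Xxy|[z Xz /psiI <-]//].
    by exists (x^-1 * y).
  by have [x _ fx] := fs i; exists (psi x); [exists x|rewrite gpsi].
(* The index of [psi X] is [q * a] through [N] and [a * b] through [X]. *)
have TY := has_indexM (subgT T) hN.1 hY.1 (@subsetT _ _) YN Nq NYa.
have XYq : has_index X (psi @` X) q.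
  have [f [hf _]] := TY.
  have [|b Xb] := @has_index_exists T X (psi @` X) (q * a)%N hX.1 hY.1.
    by exists f => x y _ _ fxy; apply/hf.
  have := has_index_uniq TY (has_indexM (subgT T) hX.1 hY.1 (@subsetT _ _) YX Xa Xb).
  have a_gt0 : (0 < a)%N by have [g _] := Xa; exact: leq_ltn_trans (ltn_ord (g 1)).
  by move/eqP; rewrite mulnC eqn_pmul2l// => /eqP ->.
have XYsolv : solv X (psi @` X).
  pose C := actker X (psi @` X).
  have KC : K `<=` C.
    move=> x; apply; last first.
      by apply: actker_index => //; have [f [hf _]] := XYq; exists f => y z Xy Xz /hf; apply.
    split; first exact: actker_subg.
    move=> y g Cy z Xz; rewrite -[z](conjgKV g) -conjRg; apply: hY.2; apply: Cy; exact: hX.2.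
  exists j.+1 => /=; apply: com_min; first exact: hY.1.
  move=> u v hu /Xj/KC Cv; apply: Cv.
  elim: {Xj} j u hu => [|i IH] u //=.
  by apply: com_min; [exact: hX.1|move=> y z /IH Xy /IH Xz; apply: (subgR hX.1)].
have [i XYi] := XYsolv.
have preX : psi @^-1` X `<=` X.
  move=> x Xx; exists (psi @^-1` X); split=> //; first exact: preim_normal.
  apply: (@solv_trans _ _ X); last by exists j.
  exists i => z dz; have : (psi @` X) (psi z).
    apply: XYi; apply: (@derS _ (psi @` (psi @^-1` X))); first by move=> _ [y ? <-].
    by rewrite -(im_der _ _ psiM); exists z.
  by move=> [y Xy /psiI <-].
have XN x : X x -> range psi x -> (psi @` X) x.
  by move=> Xx [y _ yx]; exists y => //; apply: preX; rewrite /preimage /= yx.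
have TXN g : exists2 x, X x & range psi (x^-1 * g).
  have [f [hf _]] := Nq; have [h [hh hs]] := XYq.
  have /choice[r hr] : forall i, exists x, X x /\ h x = i.
    by move=> i0; have [x Ax fx] := hs i0; exists x.
  (* Representatives of the cosets of [psi X] in [X] lie in distinct cosets of [N];
     there are [q] cosets of both kinds, so every coset of [N] is met. *)
  have rI : injective (fun i => f (r i)).
    move=> i1 i2 /hf; have [X1 h1] := hr i1; have [X2 h2] := hr i2.
    move=> /(_ Logic.I Logic.I) Nr; rewrite -h1 -h2; apply/hh => //.
    by apply: XN => //; apply: (subgM hX.1) => //; apply: (subgV hX.1).
  have [r' rK r'K] := injF_bij rI.
  exists (r (r' (f g))); first by case: (hr (r' (f g))).
  by apply/hf => //; exact: r'K.
exists i => x dx.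
have [|s [y [Ns /XYi/YN Ny ->]]] := @der_mod T i (range psi) [set: T] X hN _ x dx.
  move=> g _; have [y Xy Nyg] := TXN g^-1.
  exists (g * y), y^-1; split=> //.
  - by have := subgV hN.1 Nyg; rewrite !gnorm.
  - exact: (subgV hX.1).
  - by rewrite mulgK.
exact: (subgM hN.1).
Qed.

End Solvable.

(** * Finitely generated abelian groups *)

Section FgAbelian.
Local Open Scope ring_scope.
Local Open Scope classical_set_scope.
Variable V : zmodType.
Implicit Types (U : set V) (x y : V).

Lemma zsub_submod U : is_zsub U -> @is_submod int (zmodule V) U.
Proof.
move=> [U0 UD UN]; split=> // r x Ux; rewrite -[r *: x]/(x *~ r).
have Un n : U (x *+ n) by elim: n => // n IH; rewrite mulrS; apply: UD.
by case: r => n; rewrite ?NegzE ?mulrNz -?pmulrn; [|apply: UN].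
Qed.

Lemma submod_zsub U : @is_submod int (zmodule V) U -> is_zsub U.
Proof.
move=> hU; split=> [|x y Ux Uy|x Ux]; first exact: (submod0 hU).
  exact: (submodD hU).
exact: (submodN hU).
Qed.

Definition fg_zmod := exists s : seq V, forall U, is_zsub U ->
  (forall x, x \in s -> U x) -> forall x, U x.

Hypothesis Vfg : fg_zmod.

Lemma fg_zmod_noetherian : @noetherian int (zmodule V).
Proof.
have [s hs] := Vfg; apply: finite_module_noetherian; first exact: noetherian_int.
by exists s => x U /submod_zsub hU sU; apply: hs.
Qed.

Lemma zsub_acc (U : nat -> set V) : (forall i, is_zsub (U i)) ->
  (forall i, U i `<=` U i.+1) -> exists n, forall i, U i `<=` U n.
Proof.
by move=> hU; apply: (noetherian_acc fg_zmod_noetherian) => i; apply: zsub_submod.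
Qed.

(** The elements [x] with [x *+ i`!] in [U] form an ascending chain. *)
Lemma torsion_exponent U : is_zsub U -> exists2 n, (0 < n)%N &
  forall x e, (0 < e)%N -> U (x *+ e) -> U (x *+ n).
Proof.
move=> hU; have [||n hn] := @zsub_acc (fun i => [set x | U (x *+ i`!)]).
- move=> i; split=> /= [|x y|x].
  + by rewrite mul0rn; apply: zsub0.
  + by rewrite mulrnDl; apply: zsubD.
  + by rewrite mulNrn; apply: zsubN.
- by move=> i x /=; rewrite factS mulnC mulrnA; apply: zsubMn.
exists n`!; first exact: fact_gt0.
move=> x e e0 Ue; apply: (hn e) => /=.
by rewrite -(divnK (dvdn_fact (n := e) (m := e) _)) ?e0 ?leqnn// mulnC mulrnA; apply: zsubMn.
Qed.

(** Coefficients with respect to finitely many generators are reduced modulo [n]. *)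
Lemma multiples_finite_index n : (0 < n)%N -> exists (m : nat) (f : V -> 'I_m),
  forall x y, f x = f y -> exists z, x - y = z *+ n.
Proof.
case: n => // n _; have [s hs] := Vfg.
suff [F [f hf]] : exists (F : finType) (f : V -> F), forall x y,
    @lspan int (zmodule V) s x -> @lspan int (zmodule V) s y ->
    f x = f y -> exists z : V, x - y = z *+ n.+1.
  have hs' x : @lspan int (zmodule V) s x by move=> U /submod_zsub hU sU; apply: hs.
  exists #|F|, (fun x => enum_rank (f x)) => x y /enum_rank_inj; exact: hf.
elim: s {hs} => [|x s [F [f hf]]].
  exists unit, (fun=> tt) => x y /lspan_nil -> /lspan_nil -> _.
  by exists 0; rewrite subr0 mul0rn.
have /choice[c hc] : forall y : V, exists c : int * V,
    @lspan int (zmodule V) (x :: s) y -> @lspan int (zmodule V) s c.2 /\ y = x *~ c.1 + c.2.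
  move=> y; have [/(@lspan_cons int (zmodule V))[r [z [sz yE]]]|] :=
    pselect (@lspan int (zmodule V) (x :: s) y); last by exists (0, 0).
  by exists (r, z).
pose g (r : int) : 'I_n.+1 := inord (`|(r %% n.+1)%Z|%N).
exists ('I_n.+1 * F)%type, (fun y => (g (c y).1, f (c y).2)) => y z hy hz.
have [sy yE] := hc _ hy; have [sz zE] := hc _ hz.
have modlt (r : int) : (`|(r %% n.+1)%Z|%N < n.+1)%N.
  by rewrite -ltz_nat gez0_abs ?modz_ge0// ltz_pmod.
case=> /(congr1 (@nat_of_ord _)); rewrite !inordK// => gE /(hf _ _ sy sz)[w hw].
have {gE} : ((c y).1 %% n.+1)%Z = ((c z).1 %% n.+1)%Z.
  by rewrite -[LHS]gez0_abs ?modz_ge0// gE gez0_abs// modz_ge0.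
move=> /eqP; rewrite eqz_mod_dvd => /dvdzP[k hk].
exists (x *~ k + w); rewrite mulrnDl -hw {1}yE {1}zE opprD addrACA; congr (_ + _).
by rewrite -mulrzBr hk mulrzA -pmulrn.
Qed.

End FgAbelian.

Section Additive.
Local Open Scope group_scope.
Variables (T : groupType) (W : zmodType) (f : T -> W).
Hypothesis fM : forall x y, f (x * y) = (f x + f y)%R.

Lemma zhom1 : f 1 = 0%R.
Proof. by apply: (@addrI _ (f 1)); rewrite -fM mulg1 addr0. Qed.
Lemma zhomV x : f x^-1 = (- f x)%R.
Proof. by apply: (@addrI _ (f x)); rewrite -fM mulgV zhom1 subrr. Qed.

Lemma zhomX x n : f (x ^+ n) = (f x *+ n)%R.
Proof. by elim: n => [|n IH]; rewrite ?zhom1// expgS fM IH mulrS. Qed.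

Lemma zhom_preim_subg (U : set W) : is_zsub U -> is_subg [set x | U (f x)]%classic.
Proof.
move=> [U0 UD UN]; split=> /= [|x y|x]; rewrite ?zhom1 ?fM ?zhomV//; [exact: UD|exact: UN].
Qed.

Lemma zhom_derived x : com [set: T]%classic [set: T]%classic x -> f x = 0%R.
Proof.
apply: (@com_min _ _ _ [set x | f x = 0%R]%classic).
  apply: (@zhom_preim_subg [set 0%R]%classic).
  by split=> [|a b -> ->|a ->] /=; rewrite ?addr0 ?oppr0.
by move=> a b _ _ /=; rewrite /commg /conjg !fM !zhomV addrCA addKr addNr.
Qed.

End Additive.

Section Fingen.
Local Open Scope group_scope.
Local Open Scope classical_set_scope.

Lemma fg_zmod_im (T : groupType) (V : zmodType) (p : T -> V) : fingen T ->
  (forall x y, p (x * y) = (p x + p y)%R) -> (forall v, exists x, p x = v) -> fg_zmod V.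
Proof.
move=> [s hs] pM ps; exists (map p s) => U [U0 UD UN] sU v; have [x <-] := ps v.
have p1 := zhom1 pM.
apply: (hs [set x | U (p x)]) => [|y ys]; last by apply: sU; apply: map_f.
split=> /= [|y z Uy Uz|y Uy]; first by rewrite p1.
  by rewrite pM; apply: UD.
by rewrite (zhomV pM); apply: UN.
Qed.

(** Among [m + 1] powers of [x] two lie in the same coset, so some [x ^+ i] with
[0 < i <= m] is in [P]. *)
Lemma index_exponent (T : groupType) (P : set T) m : is_subg P ->
  index_le [set: T] P m -> exists2 e, (0 < e)%N & forall x, P (x ^+ e).
Proof.
move=> hP [f hf]; exists m`!; first exact: fact_gt0.
move=> x; have : ~ injective (fun i : 'I_m.+1 => f (x ^+ i)).
  by move=> /leq_card; rewrite !card_ord ltnn.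
move=> /existsNP[i] /existsNP[j] /not_implyP[fij /eqP ij].
wlog ltij : i j fij ij / (i < j)%N.
  move=> h; have [lij|lji|eij] := ltngtP i j; first exact: (h i j).
    by apply: (h j i) => //; rewrite eq_sym.
  by move/eqP: ij; case; apply: val_inj.
have /(hf _ _ Logic.I Logic.I) : f (x ^+ i) = f (x ^+ j) by [].
have -> : (x ^+ i)^-1 * x ^+ j = x ^+ (j - i).
  by rewrite -{1}(subnKC (ltnW ltij)) expgnDr mulKg.
move=> Pji; have d : (j - i %| m`!)%N.
  by apply: dvdn_fact; rewrite subn_gt0 ltij (leq_trans (leq_subr _ _))// -ltnS.
by rewrite -(divnK d) mulnC expgnA; apply: subgX.
Qed.

Section Cover.
Variable T : groupType.
Hypothesis Tfg : fingen T.
Let D1 : set T := com [set: T] [set: T].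

Lemma derived_normal : is_normal D1. Proof. exact: com_normal. Qed.

Lemma abelianization : exists (V : zmodType) (p : T -> V), [/\ fg_zmod V,
  forall x y, p (x * y) = (p x + p y)%R, forall x, p x = 0%R <-> D1 x &
  forall v, exists x, p x = v].
Proof.
have [V [p [pM pK ps]]] := abelian_quotient_exists (subgT T) derived_normal (@subset_refl _ _).
have pM' x y : p (x * y) = (p x + p y)%R by exact: pM.
have ps' v : exists x, p x = v by have [x _ <-] := ps v; exists x.
exists V, p; split=> //; first exact: (fg_zmod_im Tfg pM').
by move=> x; apply: pK.
Qed.

Lemma derived_torsion_exponent : exists2 n, (0 < n)%N &
  forall x e, (0 < e)%N -> D1 (x ^+ e) -> D1 (x ^+ n).
Proof.
have [V [p [Vfg pM pK _]]] := abelianization.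
have [|n n0 hn] := torsion_exponent Vfg (U := [set 0%R]).
  by split=> [|x y -> ->|x ->] //=; rewrite ?addr0 ?oppr0.
exists n => // x e e0 /pK; rewrite (zhomX pM) => /(hn _ _ e0) /= h.
by apply/pK; rewrite (zhomX pM).
Qed.

(** The preimage of [n] times the abelianisation. *)
Definition derived_powers n : set T := [set x | exists y, D1 (x^-1 * y ^+ n)].

Lemma derived_powers_normal n : is_normal (derived_powers n).
Proof.
have [V [p [Vfg pM pK ps]]] := abelianization.
have E : derived_powers n = p @^-1` [set v | exists w, v = (w *+ n)%R].
  apply/seteqP; split=> x /= [y].
    move=> /pK; rewrite pM (zhomV pM) (zhomX pM) => /eqP; rewrite addrC subr_eq0 => /eqP h.
    by exists (p y).
  move=> h; have [z zy] := ps y; exists z; apply/pK.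
  by rewrite pM (zhomV pM) (zhomX pM) zy -h addrC subrr.
have p1 := zhom1 pM.
rewrite E; split=> [|x g [w hw]]; last first.
  by exists w; rewrite -hw /= /conjg !pM (zhomV pM) addrC addrK.
split=> /= [|x y [v hv] [w hw]|x [v hv]].
- by exists 0%R; rewrite mul0rn.
- by exists (v + w)%R; rewrite pM hv hw mulrnDl.
- by exists (- v)%R; rewrite (zhomV pM) hv mulNrn.
Qed.

Lemma derived_powers_index n : (0 < n)%N -> exists m, index_le [set: T] (derived_powers n) m.
Proof.
move=> n0; have [V [p [Vfg pM pK ps]]] := abelianization.
have [m [f hf]] := multiples_finite_index Vfg n0; exists m, (fun x => f (p x)).
move=> x y _ _ /hf[w hw]; have [z zw] := ps (- w)%R; exists z; apply/pK.
by rewrite pM (zhomV pM) pM (zhomV pM) (zhomX pM) zw mulNrn -hw opprD opprK subrr.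
Qed.

Variable psi : T -> T.
Hypothesis hpsi : self_cover psi.
Let N : set T := range psi.
Let N1 : set T := com N N.

Lemma im_derived : psi @` D1 = N1.
Proof. by rewrite im_com //; exact: cover_hom. Qed.

(** On the abelianisation of [T], [psi] induces an endomorphism with image of finite
index.  Kernels of its iterates are stationary; since every element has a
multiple in the image of the [n]-th iterate, this makes the kernel torsion. *)
Lemma cover_derived_torsion x : N x -> D1 x -> exists2 e, (0 < e)%N & N1 (x ^+ e).
Proof.
move=> [y _ <-] T1y; have [psiM psiI hN [m Nm]] := hpsi.
have [V [p [Vfg pM pK ps]]] := abelianization.
have [e e0 he] := index_exponent hN.1 Nm.
have psiT1 i z : D1 z -> D1 (iter i psi z).
  elim: i => // i IH /IH h; rewrite iterS.
  have : N1 (psi (iter i psi z)) by rewrite -im_derived; exists (iter i psi z).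
  exact: comS.
have iterM i a b : iter i psi (a * b) = iter i psi a * iter i psi b.
  by elim: i => // i IH; rewrite !iterS IH psiM.
have iterV i a : iter i psi a^-1 = (iter i psi a)^-1.
  by elim: i => // i IH; rewrite !iterS IH (homV psiM).
have iter1 i : iter i psi 1 = 1 by elim: i => // i IH; rewrite iterS IH (hom1 psiM).
have [T1s T1J] := derived_normal.
pose U i : set V := [set v | exists2 z, p z = v & D1 (iter i psi z)].
have UP i z : U i (p z) -> D1 (iter i psi z).
  move=> [w /eqP]; rewrite -subr_eq0 -(zhomV pM) -pM => /eqP/pK/(psiT1 i).
  rewrite iterM iterV => h1 h2; have := subgM T1s (subgV T1s h1) h2.
  by rewrite invgM invgK mulgVK.
have [||n hn] := @zsub_acc V Vfg U.
- move=> i; split=> [|_ _ [a <- Ta] [b <- Tb]|_ [a <- Ta]].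
  + exists 1; last by rewrite iter1; exact: subg1 T1s.
    by apply: (@addrI _ (p 1)); rewrite -pM mulg1 addr0.
  + by exists (a * b); rewrite ?pM// iterM; exact: subgM T1s _ _ _ _.
  + by exists a^-1; rewrite ?(zhomV pM)// iterV; exact: subgV T1s _ _.
- by move=> i _ [z <- Tz]; exists z => //; rewrite iterS; apply: (psiT1 1%N).
(* Every element has its [e]-th power in the range of [psi]. *)
have [w hw] : exists w, y ^+ (e ^ n) = iter n psi w.
  elim: n {hn} => [|n [w hw]]; first by exists y; rewrite expn0 expg1.
  have [w' _ hw'] := he w; exists w'.
  rewrite expnSr expgnA hw iterSr hw'.
  by elim: n {hw} => // n IH; rewrite !iterS -IH (homX psiM).
exists (e ^ n)%N; first by rewrite expn_gt0 e0.
rewrite -(homX psiM) -im_derived; exists (y ^+ (e ^ n)) => //.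
rewrite hw; apply: UP; apply: (hn n.+1); exists w => //.
by rewrite iterS -hw (homX psiM); exact: subgX T1s _.
Qed.

End Cover.
End Fingen.

(** * Chains of self-covers *)

Section Chains.
Local Open Scope group_scope.
Local Open Scope classical_set_scope.
Variable T : groupType.
Hypothesis Tfg : fingen T.
Let D1 : set T := com [set: T] [set: T].

Record cover_chain (phi : nat -> T -> T) : Prop := {
  chain_cover : forall k, self_cover (phi k);
  chain_desc : forall k, range (phi k.+1) `<=` range (phi k) }.

Lemma chain_mono phi l k : cover_chain phi -> (l <= k)%N ->
  range (phi k) `<=` range (phi l).
Proof.
move=> [_ d] /subnKC <-; elim: (k - l)%N => [|n IH]; rewrite ?addn0 ?addnS//.
exact: subset_trans (d _) IH.
Qed.

(** Transport by [phi l] turns the pair of [range (phi k)] in [range (phi l)] into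
a single self-cover of [T]. *)
Lemma chain_factor phi l k : cover_chain phi -> (l <= k)%N ->
  exists psi : T -> T, self_cover psi /\ forall x, phi l (psi x) = phi k x.
Proof.
move=> hphi lk; have [hl hk] := (chain_cover hphi l, chain_cover hphi k).
have /choice[psi hpsi] : forall x, exists y, phi l y = phi k x.
  by move=> x; have [y _ <-] := chain_mono hphi lk (imageT (phi k) x); exists y.
have psiP x : range psi x <-> range (phi k) (phi l x).
  split=> [[y _ <-]|[y _]]; first by rewrite hpsi; exists y.
  by rewrite -hpsi => /(cover_inj hl) <-; exists y.
exists psi; split=> //; split.
- move=> x y; apply: (cover_inj hl).
  by rewrite (cover_hom hl) !hpsi (cover_hom hk).
- by move=> x y /(congr1 (phi l)); rewrite !hpsi => /(cover_inj hk).
- have -> : range psi = phi l @^-1` range (phi k) by apply/seteqP; split=> x /psiP.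
  exact (preim_normal (cover_hom hl) (cover_normal hk)).
- have [m [f hf]] := cover_index hk; exists m, (fun x => f (phi l x)) => x y _ _ /hf.
  by move=> /(_ Logic.I Logic.I); rewrite -(homV (cover_hom hl)) -(cover_hom hl) => /psiP.
Qed.

Lemma factor_range (f g psi : T -> T) : (forall x, f (psi x) = g x) ->
  f @` range psi = range g.
Proof.
move=> fE; apply/seteqP; split=> [_ [_ [x _ <-] <-]|_ [x _ <-]].
  by rewrite fE; exists x.
by exists (psi x); [exists x|rewrite fE].
Qed.

Lemma factor_central (f g psi : T -> T) : self_cover f -> (forall x, f (psi x) = g x) ->
  com [set: T] (range g) `<=` com (range g) (range g) ->
  com [set: T] (range psi) `<=` com (range psi) (range psi).
Proof.
move=> hf fE TN z hz; have : com (f @` [set: T]) (f @` range psi) (f z).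
  by rewrite -(im_com (cover_hom hf)); exists z.
rewrite (factor_range fE) => /(comS (@subsetT _ _) (@subset_refl _ _))/TN.
rewrite -(factor_range fE) -(im_com (cover_hom hf)) => -[z' hz' /(cover_inj hf) <-].
exact: hz'.
Qed.

Lemma chain_shift phi L : cover_chain phi -> exists phi',
  cover_chain phi' /\ forall k x, phi L (phi' k x) = phi (L + k)%N x.
Proof.
move=> hphi; have /choice[phi' h] := fun k => chain_factor hphi (leq_addr k L).
exists phi'; split=> [|k x]; last by case: (h k).
split=> k; first by case: (h k).
move=> _ [x _ <-].
have [|z _ zx] := @chain_desc _ hphi (L + k)%N (phi (L + k.+1)%N x).
  by rewrite addnS; exists x.
exists z => //; apply: (cover_inj (chain_cover hphi L)).
by rewrite (h k).2 (h k.+1).2.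
Qed.

Lemma cover_im_normal (psi : T -> T) (A : set T) : self_cover psi -> is_subg A ->
  (forall al : T -> T, is_hom al -> forall x, A x -> A (al x)) -> is_normal (psi @` A).
Proof.
move=> hpsi hA Aal; split=> [|_ g [x Ax <-]]; first exact: im_subg (cover_hom hpsi) _ hA.
have [al [alM _ alE]] := cover_conj g hpsi; exists (al x); [exact: Aal|exact: alE].
Qed.

Lemma derived_hom (al : T -> T) : is_hom al -> forall x, D1 x -> D1 (al x).
Proof.
move=> alM x Tx; have : com (range al) (range al) (al x).
  by rewrite -(im_com alM); exists x.
exact: comS.
Qed.

Lemma cover_index_im (psi : T -> T) A P m : self_cover psi -> index_le A P m ->
  index_le (psi @` A) (psi @` P) m.
Proof.
move=> hpsi [f hf]; have psiM := cover_hom hpsi.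
have /choice[g hg] : forall y, exists x, range psi y -> psi x = y.
  by move=> y; have [[x _ <-]|] := pselect (range psi y); [exists x|exists 1].
have gpsi x : g (psi x) = x by apply: (cover_inj hpsi); apply: hg; exists x.
exists (fun y => f (g y)) => _ _ [x Ax <-] [y Ay <-]; rewrite !gpsi => /hf h.
by rewrite -(homV psiM) -psiM; exists (x^-1 * y) => //; apply: h.
Qed.

(** A commutator [[~ x, g]] with [x] in [range (phi k)] is torsion in the
abelianisation of [range (phi k)] by [cover_derived_torsion], of exponent [n].
If [g] acts on the quotient of that abelianisation by its [n]-th multiples as
an element of [range (phi k)] does, then the commutator is an [n]-th multiple
as well, of an element that is torsion in its turn, so it vanishes. *)
Lemma chain_eventually_central phi : cover_chain phi -> exists L, forall l k,
  (L <= l <= k)%N -> com (range (phi l)) (range (phi k)) `<=`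
     com (range (phi k)) (range (phi k)).
Proof.
move=> hphi; have [n n0 hn] := derived_torsion_exponent Tfg.
have [m Dm] := derived_powers_index Tfg n0.
have hD := derived_powers_normal Tfg n.
have Dal (al : T -> T) : is_hom al -> forall x, derived_powers n x -> derived_powers n (al x).
  move=> alM x [y /(derived_hom alM)]; rewrite alM (homV alM) (homX alM) => h.
  by exists (al y).
have Pn k := cover_im_normal (chain_cover hphi k) hD.1 Dal.
have [L hL] := action_stabilises Tfg (chain_desc hphi) (fun k => cover_normal (chain_cover hphi k))
  Pn (fun k => cover_index_im (chain_cover hphi k) Dm).
exists L => l k lk; have [phiM phiI hN [M NM]] := chain_cover hphi k.
apply: com_min => [|g x Gg Gx]; first exact: com_subg.
rewrite -invgR; apply: (subgV (com_subg _ _)).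
have [V [p [Vfg pM pK ps]]] := abelianization Tfg.
have [h Gh /(_ k x Gx)[d [y Tdy] dE]] := hL l k lk g Gg.
have [c Tc cE] : (phi k @` D1) ([~ x, h] ^ (h^-1 * g)).
  rewrite im_derived; last exact: chain_cover.
  have /com_normal := hN.2; move/(_ _ hN.2) => [_]; apply.
  exact: mem_com.
have gE : [~ x, g] = phi k (d * c).
  by rewrite phiM dE cE /commg /conjg !gnorm.
have [e e0 he] : exists2 e, (0 < e)%N & com (range (phi k)) (range (phi k)) ([~ x, g] ^+ e).
  apply: (cover_derived_torsion Tfg (chain_cover hphi k)); first exact: normalRl.
  exact: mem_com.
have {}he : D1 ((d * c) ^+ e).
  move: he; rewrite gE -(homX phiM) -im_derived; last exact: chain_cover.
  by move=> [z Tz /phiI <-].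
have pdc : p (d * c) = p (y ^+ n).
  rewrite pM ((pK c).2 Tc) addr0; apply/esym/eqP.
  by rewrite -subr_eq0 addrC -(zhomV pM) -pM; apply/eqP/pK.
rewrite gE -im_derived; last exact: chain_cover.
exists (d * c) => //; apply/pK; rewrite pdc; apply/pK.
apply: (hn y (n * e)%N); first by rewrite muln_gt0 n0.
by apply/pK; rewrite expgnA (zhomX pM) -pdc -(zhomX pM); apply/pK.
Qed.

End Chains.

(** * The second factor of the lower central series *)
Lemma commg_mul_central (T : groupType) (a b u v : T) :
  commute a u -> commute b u -> commute a v -> commute b v -> commute u v ->
  ([~ a * u, b * v] = [~ a, b])%g.
Proof.
move=> au bu av bv uv.
have E (x y : T) : ([~ x, y] = (y * x)^-1 * (x * y))%g by rewrite /commg /conjg !gnorm.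
have -> : ([~ a * u, b * v] = [~ a, b] ^ (u * v))%g.
  rewrite !E /conjg.
  have -> : (b * v * (a * u) = b * a * (u * v))%g.
    by rewrite -mulgA (mulgA v) -av !mulgA -(mulgA _ v u) -uv !mulgA.
  have -> : (a * u * (b * v) = a * b * (u * v))%g.
    by rewrite -mulgA (mulgA u) -bu !mulgA.
  by rewrite !gnorm.
have ua := commute_sym au; have ub := commute_sym bu.
have va := commute_sym av; have vb := commute_sym bv.
have h c : commute c a -> commute c b -> commute c (a^-1 * (b^-1 * (a * b)))%g.
  by move=> ca cb; do !apply: commuteM => //; apply: commuteV.
have hu := h u ua ub; have hv := h v va vb.
apply/conjg_fixP/commgP/commuteM; apply: commute_sym; [exact: hu|exact: hv].
Qed.

Section ClassTwo.
Local Open Scope group_scope.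
Local Open Scope classical_set_scope.
Variable T : groupType.
Hypothesis Tfg : fingen T.
Let D1 : set T := com [set: T] [set: T].
Let L3 : set T := com D1 [set: T].

Lemma lower3_normal : is_normal L3.
Proof. by apply: com_normal => //; exact: (derived_normal T).2. Qed.

Lemma lower3_derived : L3 `<=` D1.
Proof. exact: com_subl (derived_normal T). Qed.

Lemma mem_derived x y : D1 [~ x, y]. Proof. exact: mem_com. Qed.

Record gamma2_quotient (W : zmodType) (p : T -> W) : Prop := {
  g2M : forall x y, D1 x -> D1 y -> p (x * y) = (p x + p y)%R;
  g2K : forall x, D1 x -> (p x = 0%R <-> L3 x);
  g2_surj : forall w, exists2 x, D1 x & p x = w }.

Lemma gamma2_quotient_exists : exists (W : zmodType) (p : T -> W), gamma2_quotient p.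
Proof.
have [|W [p [pM pK ps]]] := abelian_quotient_exists (derived_normal T).1 lower3_normal.
  exact: comS.
by exists W, p.
Qed.

Section Fixed.
Variables (W : zmodType) (p : T -> W).
Hypothesis hp : gamma2_quotient p.

Lemma g21 : p 1 = 0%R.
Proof. exact: ((g2K hp (subg1 (derived_normal T).1)).2 (subg1 lower3_normal.1)). Qed.

Lemma g2V x : D1 x -> p x^-1 = (- p x)%R.
Proof.
move=> Tx; apply: (@addrI _ (p x)); rewrite -(g2M hp) ?mulgV ?g21 ?subrr//.
exact: (subgV (derived_normal T).1).
Qed.

Lemma g2X x n : D1 x -> p (x ^+ n) = (p x *+ n)%R.
Proof.
move=> Tx; elim: n => [|n IH]; first by rewrite g21.
by rewrite expgS (g2M hp)// ?IH ?mulrS//; apply: (subgX _ (derived_normal T).1).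
Qed.

Lemma g2J x g : D1 x -> p (x ^ g) = p x.
Proof.
move=> Tx; have -> : x ^ g = x * [~ x, g] by rewrite commgEl mulVKg.
have L3xg : L3 [~ x, g] by apply: mem_com.
have D1xg := lower3_derived L3xg.
by rewrite (g2M hp)// ((g2K hp D1xg).2 L3xg) addr0.
Qed.

Lemma g2_commMl x y z : p [~ x * y, z] = (p [~ x, z] + p [~ y, z])%R.
Proof.
have -> : [~ x * y, z] = [~ x, z] ^ y * [~ y, z] by rewrite /commg /conjg !gnorm.
rewrite (g2M hp); [by rewrite g2J//; apply: mem_derived| |exact: mem_derived].
by apply: (derived_normal T).2; apply: mem_derived.
Qed.

Lemma g2_commMr x y z : p [~ x, y * z] = (p [~ x, y] + p [~ x, z])%R.
Proof.
by rewrite -invgR g2V ?g2_commMl ?opprD -?g2V ?invgR//; apply: mem_derived.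
Qed.


(** The commutators of generators generate, by bilinearity. *)
Lemma g2_fg : fg_zmod W.
Proof.
have [s hs] := Tfg; exists [seq p [~ x, y] | x <- s, y <- s] => U hU sU w.
have U_comm x y : U (p [~ x, y]).
  have := hs [set x | forall y, U (p [~ x, y])]; apply=> {x y}.
    split=> /= [y|x x' h h' y|x h y].
    - by rewrite comm1g g21; apply: (zsub0 hU).
    - by rewrite g2_commMl; apply: (zsubD hU).
    - rewrite (@zhomV _ _ (fun x => p [~ x, y])); first exact: (zsubN hU).
      by move=> ? ?; apply: g2_commMl.
  move=> x xs /= y; have := hs [set y | U (p [~ x, y])]; apply=> {y}.
    apply: (@zhom_preim_subg _ _ (fun y => p [~ x, y])) => // ? ?; exact: g2_commMr.
  by move=> y ys /=; apply: sU; apply: allpairs_f.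
have [x T1x <-] := g2_surj hp w.
suff [] : ([set x | D1 x /\ U (p x)]) x by [].
apply: (T1x) => [|_ [a [b [_ _ ->]]]]; last by split; [exact: mem_derived|exact: U_comm].
have hD1 := (derived_normal T).1.
split=> /= [|a b [Ta Ua] [Tb Ub]|a [Ta Ua]].
- by rewrite g21; split; [exact: (subg1 hD1)|exact: (zsub0 hU)].
- by rewrite (g2M hp)//; split; [exact: (subgM hD1)|exact: (zsubD hU)].
- by rewrite g2V//; split; [exact: (subgV hD1)|exact: (zsubN hU)].
Qed.

Variable psi : T -> T.
Hypothesis hpsi : self_cover psi.
Let N : set T := range psi.
Let N1 : set T := com N N.
Hypothesis TN : com [set: T] N `<=` N1.

(** An instance of the three subgroups lemma: as [[N, T]] is contained in [[N, N]],
conjugation by [g] multiplies two elements of [N] by elements central modulo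
the third term of the lower central series of [N]. *)
Lemma N1_central x g : N1 x -> com N1 N [~ x, g].
Proof.
have [_ _ hN _] := hpsi; have hN1 : is_normal N1 := com_normal hN.2 hN.2.
have hN2 : is_normal (com N1 N) := com_normal hN1.2 hN.2.
have [Q [pi [piM piK _]]] := quotient_exists hN2.
have cen a b : N1 a -> N b -> pi a * pi b = pi b * pi a.
  move=> Na Nb; have /piK := mem_com (A := N1) (B := N) Na Nb.
  by rewrite (homR piM) => /eqP/commgP.
have hg a : N a -> N1 [~ a, g].
  by move=> Na; rewrite -invgR; apply: (subgV hN1.1); apply: TN; exact: mem_com.
move=> N1x; apply/piK; rewrite (homR piM); apply/eqP/conjg_fixP; rewrite -(homJ piM).
have : [set x | pi (x ^ g) = pi x] x; last by [].
apply: N1x => [|_ [a [b [Na Nb ->]]]] /=.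
  split=> /= [|u v hu hv|u hu]; first by rewrite conj1g.
    by rewrite conjMg (piM (u ^ g)) hu hv -piM.
  by rewrite conjVg !(homV piM) hu.
rewrite conjRg !(homR piM).
have -> : a ^ g = a * [~ a, g] by rewrite commgEl mulVKg.
have -> : b ^ g = b * [~ b, g] by rewrite commgEl mulVKg.
have Cag := hg a Na; have Cbg := hg b Nb.
have Nag : N [~ a, g] by apply: (normalRl _ hN).
have Nbg : N [~ b, g] by apply: (normalRl _ hN).
rewrite (piM a) (piM b); set u := pi [~ a, g]; set v := pi [~ b, g].
have ub : commute u (pi b) by apply: cen.
have ua : commute (pi a) u by apply/commute_sym/cen.
have uv : commute u v by apply: cen.
have va : commute (pi a) v by apply/commute_sym; apply: cen.
have vb : commute (pi b) v by apply/commute_sym; apply: cen.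
by apply: commg_mul_central => //; apply/commute_sym.
Qed.


Lemma N1_im_derived : N1 = psi @` D1.
Proof. by rewrite /N1 /N -im_derived. Qed.

Lemma im_lower3 : com N1 N = psi @` L3.
Proof. by rewrite N1_im_derived /L3 (im_com (cover_hom hpsi)). Qed.

Lemma g2_psiJ u u' g : D1 u -> D1 u' -> psi u' = psi u ^ g -> p u' = p u.
Proof.
move=> Tu Tu' uu'; have [psiM psiI _ _] := hpsi.
have : com N1 N [~ psi u, g] by apply: N1_central; rewrite N1_im_derived; exists u.
rewrite im_lower3 commgEl -uu' -(homV psiM) -psiM => -[t T2t /psiI tE].
have -> : u' = u * t by rewrite tE mulVKg.
have T1t := lower3_derived T2t.
by rewrite (g2M hp)// ((g2K hp T1t).2 T2t) addr0.
Qed.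

(** The commutator pairing between [N] and [T], with values in the second lower
central factor of [N].  It is read in [W], which is the same factor for [T], by
transport along [psi]; this makes it comparable with the pairing of [T] with
itself. *)
Lemma cover_pairing : exists r : T -> T -> W, [/\
  forall y g g', r y (g * g') = (r y g + r y g')%R,
  forall y y' g, r (y * y') g = (r y g + r y' g)%R,
  forall y x, r y (psi x) = p [~ y, x] &
  forall y g, exists u, [/\ D1 u, psi u = [~ psi y, g] & p u = r y g]].
Proof.
have [psiM psiI hN _] := hpsi; have T1g := (derived_normal T).1.
have /choice[c hc] : forall yg : T * T, exists u, D1 u /\ psi u = [~ psi yg.1, yg.2].
  move=> [y g] /=; have : N1 [~ psi y, g].
    by rewrite -invgR; apply: (subgV (com_subg _ _)); apply: TN; apply: mem_com => //; exists y.
  by rewrite N1_im_derived => -[u Tu uE]; exists u.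
have psiV := homV psiM.
exists (fun y g => p (c (y, g))); split.
- move=> y g g'; have [Tc e3] := hc (y, g * g').
  have [Ta ea] := hc (y, g); have [Tb eb] := hc (y, g').
  have Td : D1 ((c (y, g'))^-1 * c (y, g * g')) by apply: (subgM T1g) => //; apply: (subgV T1g).
  rewrite -(mulVKg (c (y, g')) (c (y, g * g'))) (g2M hp)// addrC; congr (_ + _)%R.
  apply: (@g2_psiJ _ _ g') => //; by rewrite psiM psiV e3 ea eb /= /commg /conjg !gnorm.
- move=> y y' g; have [Tc e3] := hc (y * y', g).
  have [Ta ea] := hc (y, g); have [Tb eb] := hc (y', g).
  have Td : D1 (c (y * y', g) * (c (y', g))^-1) by apply: (subgM T1g) => //; apply: (subgV T1g).
  rewrite -(mulgVK (c (y', g)) (c (y * y', g))) (g2M hp)//; congr (_ + _)%R.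
  apply: (@g2_psiJ _ _ (psi y')) => //; by rewrite psiM psiV e3 ea eb /= psiM /commg /conjg !gnorm.
- move=> y x; have [Ta ea] := hc (y, psi x); congr p; apply: psiI.
  by rewrite ea (homR psiM).
- by move=> y g; have [Ta ea] := hc (y, g); exists (c (y, g)).
Qed.

End Fixed.

Lemma fg_zmod_ffun (W : zmodType) d : fg_zmod W -> fg_zmod {ffun 'I_d -> W}.
Proof.
move=> [s hs]; pose dl i (w : W) : {ffun 'I_d -> W} := [ffun j => if j == i then w else 0%R].
exists [seq dl i w | i <- enum 'I_d, w <- s] => U hU sU f.
have Udl i w : U (dl i w).
  have := hs [set w | U (dl i w)]; apply; last first.
    by move=> w' ws; apply: sU; apply: allpairs_f; rewrite ?mem_enum.
  split=> /= [|x y Ux Uy|x Ux].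
  - have -> : dl i 0%R = 0%R by apply/ffunP=> j; rewrite !ffunE; case: ifP.
    exact: (zsub0 hU).
  - have -> : dl i (x + y)%R = (dl i x + dl i y)%R.
      by apply/ffunP=> j; rewrite !ffunE; case: ifP => _; rewrite ?addr0.
    exact: (zsubD hU).
  - have -> : dl i (- x)%R = (- dl i x)%R.
      by apply/ffunP=> j; rewrite !ffunE; case: ifP => _; rewrite ?oppr0.
    exact: (zsubN hU).
have -> : f = (\sum_i dl i (f i))%R.
  apply/ffunP => j; rewrite sum_ffunE (bigD1 j)//= ffunE eqxx big1 ?addr0// => i ij.
  by rewrite ffunE eq_sym (negPf ij).
by apply: (big_ind U); [exact: (zsub0 hU)|exact: (zsubD hU)|].
Qed.

(** Elements of [T] give homomorphisms from [N] to its second lower central factor,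
among which those of [N] give the inner ones; modulo the latter, torsion has a
bounded exponent [n1].  So [g ^+ n1] is in [C * N], where [C] acts trivially.
Commutators with [N] lie in [[N, N]] by hypothesis.  Commutators of two
elements of [C] are torsion in [W], because powers of elements of [C] are in
[N]; they are killed by the exponent [n2] of the torsion of [W]. *)
Lemma cover_derived_exponent : exists2 n, (0 < n)%N & forall psi : T -> T,
  self_cover psi ->
  com [set: T] (range psi) `<=` com (range psi) (range psi) ->
  forall x, D1 x -> mulset (com (range psi) (range psi)) L3 (x ^+ n).
Proof.
have [W [p hp]] := gamma2_quotient_exists; have Wfg := g2_fg hp.
have [s hs] := Tfg; pose d := size s.
pose ad (x : T) : {ffun 'I_d -> W} := [ffun i : 'I_d => p [~ s`_i, x]].
have adM x y : ad (x * y) = (ad x + ad y)%R.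
  by apply/ffunP => i; rewrite !ffunE (g2_commMr hp).
have had : is_zsub (range ad).
  split=> [|_ _ [x _ <-] [y _ <-]|_ [x _ <-]].
  - by exists 1 => //; rewrite (zhom1 adM).
  - by exists (x * y) => //; rewrite adM.
  - by exists x^-1 => //; rewrite (zhomV adM).
have [n1 n1_gt0 hn1] := torsion_exponent (fg_zmod_ffun d Wfg) had.
have h0 : is_zsub [set 0%R : W] by split=> [|x y -> ->|x ->] /=; rewrite ?addr0 ?oppr0.
have [n2 n2_gt0 hn2] := torsion_exponent Wfg h0.
exists (n1 * n1 * n2)%N; first by rewrite !muln_gt0 n1_gt0.
move=> psi hpsi TN; have [psiM psiI hN [m Nm]] := hpsi.
set N1 := com _ _; have N1_derived : N1 `<=` D1 by apply: comS.
have [r [rM rMl rpsi rE]] := cover_pairing hp hpsi TN.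
have [e e_gt0 he] := index_exponent hN.1 Nm.
(* [c] acts trivially on [N] modulo the third term of its lower central series. *)
have step g : exists c x, g ^+ n1 = c * psi x /\ forall y, r y c = 0%R.
  pose b : {ffun 'I_d -> W} := [ffun i : 'I_d => r s`_i g].
  have [x _ xE] : range ad (b *+ n1)%R.
    apply: (hn1 _ e e_gt0); have [x _ xE] := he g; exists x => //.
    apply/ffunP => i; rewrite !ffunE -rpsi xE (zhomX (rM _)).
    by elim: (e) => [|k IH]; rewrite ?mulr0n ?ffunE// !mulrS ffunE -IH !ffunE.
  exists (g ^+ n1 * (psi x)^-1), x; rewrite mulgVK; split=> // y.
  have := hs [set y | r y (g ^+ n1 * (psi x)^-1) = 0%R]; apply=> {y}.
    exact: (@zhom_preim_subg _ _ (fun y => r y (g ^+ n1 * (psi x)^-1)) (fun a b => rMl a b _) _ h0).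
  move=> y ys /=; have ysd : (index y s < d)%N by rewrite index_mem.
  have /ffunP/(_ (Ordinal ysd)) := xE; rewrite !ffunE /= nth_index// => xE'.
  rewrite rM (zhomV (rM y)) (zhomX (rM y)) rpsi xE'; apply/eqP; rewrite subr_eq0; apply/eqP.
  by elim: (n1) => [|k IH]; rewrite ?mulr0n ?ffunE// !mulrS ffunE -IH !ffunE /= nth_index.
pose A0 : set W := [set w | exists2 a, N1 a & p a = w].
have N1g : is_subg N1 := com_subg _ _.
have hA0 : is_zsub A0.
  split=> [|_ _ [a Na <-] [b Nb <-]|_ [a Na <-]].
  - by exists 1; [exact: (subg1 N1g)|rewrite (g21 hp)].
  - by exists (a * b); [exact: (subgM N1g)|rewrite (g2M hp)//; apply: N1_derived].
  - by exists a^-1; [exact: (subgV N1g)|rewrite (g2V hp)//; apply: N1_derived].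
have N1l g x : N1 [~ g, psi x] by apply: TN; apply: mem_com => //; exists x.
have N1r g x : N1 [~ psi x, g] by rewrite -invgR; apply: (subgV N1g).
have key g g' : A0 (p [~ g, g'] *+ (n1 * n1 * n2))%R.
  have [c [x [gE rc]]] := step g; have [c' [x' [gE' rc']]] := step g'.
  have commX (u v : T) k : p [~ u ^+ k, v] = (p [~ u, v] *+ k)%R.
    exact: (@zhomX _ _ (fun u => p [~ u, v]) (fun a b => g2_commMl hp a b v)).
  have commXr (u v : T) k : p [~ u, v ^+ k] = (p [~ u, v] *+ k)%R.
    exact: (@zhomX _ _ (fun v => p [~ u, v]) (fun a b => g2_commMr hp u a b)).
  rewrite !mulrnA -commX -commXr gE gE' !(g2_commMl hp) !(g2_commMr hp).
  have cc0 : (p [~ c, c'] *+ n2 = 0)%R.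
    apply: (hn2 _ e e_gt0) => /=; rewrite -commX; have [z _ zE] := he c.
    apply/(g2K hp (mem_derived _ _)); rewrite -zE; have [u [Tu uE pu]] := rE z c'.
    have T2u : L3 u by apply/(g2K hp Tu); rewrite pu rc'.
    have : com N1 (range psi) (psi u) by rewrite (im_lower3 hpsi); exists u.
    by rewrite uE; apply: comS.
  have A0p u : N1 u -> A0 (p u) by exists u.
  rewrite !mulrnDl cc0 add0r.
  by do !apply: (zsubD hA0); apply: (zsubMn _ hA0); apply: A0p;
     rewrite ?(N1l, N1r)//; exact: N1l.
have hD1 := (derived_normal T).1.
move=> x T1x; set n := (n1 * n1 * n2)%N in key *.
suff [_ [a Na pa]] : [set x | D1 x /\ A0 (p x *+ n)%R] x.
  have T1a := N1_derived a Na; have T1xn : D1 (x ^+ n) by apply: (subgX _ hD1).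
  exists a, (a^-1 * x ^+ n); rewrite mulVKg; split=> //.
  have T1ax := subgM hD1 (subgV hD1 T1a) T1xn.
  apply/(g2K hp T1ax); rewrite (g2M hp)//; last exact: (subgV hD1).
  by rewrite (g2V hp)// (g2X hp)// pa addNr.
apply: (T1x) => [|_ [a [b [_ _ ->]]]]; last by split; [exact: mem_derived|exact: key].
split=> /= [|a b [Ta Aa] [Tb Ab]|a [Ta Aa]].
- by rewrite (g21 hp) mul0rn; split; [exact: (subg1 hD1)|exact: (zsub0 hA0)].
- by rewrite (g2M hp)// mulrnDl; split; [exact: (subgM hD1)|exact: (zsubD hA0)].
- by rewrite (g2V hp)// mulNrn; split; [exact: (subgV hD1)|exact: (zsubN hA0)].
Qed.

(** For [l] large, elements of [range (phi l)] are products of an element of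
[range (phi k)] and an [n]-th multiple [u] in the abelianisation of [T].
Commutators with [u] are [n]-th powers in the second lower central factor, to
which [cover_derived_exponent] applies. *)
Lemma chain_class_two phi : cover_chain phi ->
  (forall k, com [set: T] (range (phi k)) `<=` com (range (phi k)) (range (phi k))) ->
  exists L, forall l k, (L <= l <= k)%N ->
    com (range (phi l)) (range (phi l)) `<=`
    mulset (range (phi k)) (com (com (range (phi l)) (range (phi l))) (range (phi l))).
Proof.
move=> hphi TN; have [n n_gt0 hn] := cover_derived_exponent.
have [m hm] := derived_powers_index Tfg n_gt0.
have [L hL] := chain_stabilises hm (chain_desc hphi).
exists L => l k lk; have /andP[_ lek] := lk.
have hl := chain_cover hphi l; have hk := chain_cover hphi k.
have [psi [hpsi psiE]] := chain_factor hphi lek.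
have [W [p hp]] := gamma2_quotient_exists.
have [r [rM rMl rpsi rE]] := cover_pairing hp hl (TN l).
have hk1 : is_normal (mulset (range (phi k))
    (com (com (range (phi l)) (range (phi l))) (range (phi l)))).
  apply: mulset_normal; first exact: cover_normal.
  have [_ jl] := cover_normal hl; apply: com_normal => //; exact: (com_normal jl jl).2.
apply: com_min => [|_ g' [g _ <-] Gg']; first exact: hk1.1.
have [h Gh [y Ty]] := hL l k lk g' Gg'.
set u := h^-1 * g' in Ty.
have -> : [~ phi l g, g'] = [~ phi l g, u] * [~ phi l g, h] ^ u.
  by rewrite /u /commg /conjg !gnorm.
have hkN := cover_normal hk.
apply: (subgM hk1.1); last first.
  apply: mulsetl; first exact: com_subg.
  by apply: hkN.2; exact: (normalRr _ hkN).
have [v [Tv vE pv]] := rE g u; have [w [Tw wE pw]] := rE g y.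
have hD1 := (derived_normal T).1.
have vw : p v = p (w ^+ n).
  rewrite (g2X hp)// pv pw -(zhomX (rM g)); apply/esym/eqP.
  by rewrite -subr_eq0 addrC -(zhomV (rM g)) -rM; apply/eqP/(zhom_derived (rM g)).
have psiN : phi l @` range psi = range (phi k) by apply: factor_range.
have [a [b [Na T2b abE]]] := hn psi hpsi (factor_central hl psiE (TN k)) w Tw.
exists (phi l a), (phi l (a^-1 * v)); split.
- have : (phi l @` com (range psi) (range psi)) (phi l a) by exists a.
  rewrite (im_com (cover_hom hl)) psiN; exact: com_subl hkN _.
- rewrite (im_lower3 hl); exists (a^-1 * v) => //.
  have T1a : D1 a by apply: comS Na.
  have T2T1 := lower3_derived T2b.
  apply/(g2K hp (subgM hD1 (subgV hD1 T1a) Tv)); rewrite (g2M hp)//; last exact: (subgV hD1).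
  by rewrite (g2V hp)// vw abE (g2M hp)// ((g2K hp T2T1).2 T2b) addr0 addNr.
- by rewrite -(cover_hom hl) mulVKg vE.
Qed.

End ClassTwo.

(** * The metabelian quotient *)

Section IdealMul.
Local Open Scope ring_scope.
Local Open Scope classical_set_scope.
Variables (R : comNzRingType) (V : lmodType R).
Implicit Types (I : set R) (U W : set V).

Definition ideal_mul I U (v : V) : Prop := forall W, is_submod W ->
  (forall a u, I a -> U u -> W (a *: u)) -> W v.

Lemma ideal_mul_submod I U : is_submod (ideal_mul I U).
Proof.
split=> [W hW _|x y hx hy W hW h|r x hx W hW h]; first exact: submod0.
  by apply: submodD => //; [apply: hx|apply: hy].
by apply: submodZ => //; apply: hx.
Qed.

Lemma mem_ideal_mul I U a u : I a -> U u -> ideal_mul I U (a *: u).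
Proof. by move=> Ia Uu W _; apply. Qed.

Lemma ideal_mulS I U U' : U `<=` U' -> ideal_mul I U `<=` ideal_mul I U'.
Proof. by move=> UU x hx W hW h; apply: hx => // a u Ia /UU; apply: h. Qed.

Lemma ideal_mul_lspan I (s : seq V) U W : U `<=` lspan s -> is_submod W ->
  (forall a y, I a -> y \in s -> W (a *: y)) -> ideal_mul I U `<=` W.
Proof.
move=> Us hW h v; apply=> // a u Ia /Us us.
apply: (us [set u | W (a *: u)]) => [|y ys]; last exact: (h a y).
split=> /= [|x y Wx Wy|r x Wx].
- by rewrite scaler0; exact: (submod0 hW).
- by rewrite scalerDr; exact: (submodD hW).
- by rewrite scalerA mulrC -scalerA; exact: (submodZ hW).
Qed.

End IdealMul.

Section Metabelian.
Local Open Scope group_scope.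
Local Open Scope classical_set_scope.
Variable T : groupType.
Hypothesis Tfg : fingen T.
Let D1 : set T := com [set: T] [set: T].
Let L3 : set T := com D1 [set: T].
Let D2 : set T := com D1 D1.

Lemma derived2_normal : is_normal D2.
Proof. by apply: com_normal; exact: (derived_normal T).2. Qed.

(** The quotient of the first by the second derived subgroup, as a module.  Scalars
come from a commutative ring in which every element of [T] acts by conjugation;
it stands for the integral group ring of the abelianisation. *)
Record derived_module (R : comNzRingType) (V : lmodType R) (p : T -> V) : Prop := {
  dmM : forall x y, D1 x -> D1 y -> p (x * y) = (p x + p y)%R;
  dmK : forall x, D1 x -> (p x = 0%R <-> D2 x);
  dm_surj : forall v, exists2 x, D1 x & p x = v;
  dm_act : forall g, exists r : R, forall x, D1 x -> (r *: p x)%R = p (x ^ g);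
  dm_submod : forall U : set V, is_zsub U ->
    (forall g x, D1 x -> U (p x) -> U (p (x ^ g))) -> is_submod U;
  dm_noetherian : noetherian V }.

(** Modulo [X] the generators commute with each other, hence with everything. *)
Lemma derived_sub (X : set T) (s : seq T) :
  (forall H : set T, is_subg H -> (forall x, x \in s -> H x) -> forall x, H x) ->
  is_normal X -> (forall x y, x \in s -> y \in s -> X [~ x, y]) -> D1 `<=` X.
Proof.
move=> hs hX sX; have [Q [pi [piM piK _]]] := quotient_exists hX.
have C (q : Q) : is_subg [set x | commute q (pi x)].
  split=> /= [|x y hx hy|x hx]; first by rewrite (hom1 piM); apply: commute1.
    by rewrite piM; apply: commuteM.
  by rewrite (homV piM); apply: commuteV.
have h1 x y : x \in s -> commute (pi x) (pi y).
  move=> xs; apply: (hs _ (C (pi x))) => {}y ys /=.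
  by apply/commgP/eqP; rewrite -(homR piM); apply/piK/sX.
have h2 x y : commute (pi x) (pi y).
  by apply: commute_sym; apply: (hs _ (C (pi y))) => {}x xs; apply/commute_sym/h1.
apply: com_min => [|x y _ _]; first by case: hX.
by apply/piK; rewrite (homR piM); apply/eqP/commgP.
Qed.

(** The scalars are integer polynomials in one variable for each generator of [T] and
one for its inverse.  Conjugations commute on this quotient because the derived
subgroup acts trivially. *)
Lemma derived_module_exists : exists (R : comNzRingType) (V : lmodType R) (p : T -> V),
  derived_module p.
Proof.
have [hD1 jD1] := derived_normal T; have [hD2 jD2] := derived2_normal.
have T31 : D2 `<=` D1 by exact: comS.
have [V [p [pM pK ps]]] := abelian_quotient_exists hD1 derived2_normal (@subset_refl _ _).
have [s hs] := Tfg.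
have /choice[l hl] : forall v, exists x, D1 x /\ p x = v.
  by move=> v; have [x Tx px] := ps v; exists x.
have p1 : p 1 = 0%R by apply/pK; [exact: (subg1 hD1)|exact: (subg1 hD2)].
have zhomV' x : D1 x -> p x^-1 = (- p x)%R.
  move=> Tx; apply: (@addrI _ (p x)); rewrite -pM ?mulgV ?p1 ?subrr//; exact: (subgV hD1).
have pE x y : D1 x -> D1 y -> D2 (x^-1 * y) -> p x = p y.
  move=> Tx Ty h; apply/esym/eqP; rewrite -subr_eq0 addrC -zhomV'// -pM//; last exact: (subgV hD1).
  by apply/eqP/pK => //; apply: (subgM hD1) => //; apply: (subgV hD1).
pose act g v := p (l v ^ g).
have actE g x : D1 x -> act g (p x) = p (x ^ g).
  move=> Tx; have [Tl pl] := hl (p x); apply: pE; try exact: jD1.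
  rewrite -conjVg -conjMg; apply: jD2; apply/pK.
    by apply: (subgM hD1) => //; apply: (subgV hD1).
  by rewrite pM ?zhomV'// ?pl ?addNr//; apply: (subgV hD1).
have actD g u v : act g (u + v)%R = (act g u + act g v)%R.
  have [x Tx <-] := ps u; have [y Ty <-] := ps v.
  rewrite -pM// !actE//; last exact: (subgM hD1).
  by rewrite conjMg pM//; apply: jD1.
have actC g h v : act g (act h v) = act h (act g v).
  have [x Tx <-] := ps v; rewrite !actE//; try exact: jD1.
  apply: pE; [exact: (jD1 _ g (jD1 _ h Tx))|exact: (jD1 _ h (jD1 _ g Tx))|].
  rewrite -!conjgM; set y := x ^ (h * g).
  have -> : x ^ (g * h) = y ^ [~ h, g]^-1.
    by rewrite /y -conjgM; congr (_ ^ _); rewrite /commg /conjg !gnorm.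
  have Ty : D1 y by apply: jD1.
  by rewrite -commgEl; apply: mem_com => //; apply: (subgV hD1) => //; apply: mem_com.
pose s' := s ++ map (fun x => x^-1) s; pose d := size s'.
have [rho [hrho rt rU _]] := @Zpoly_action d V (fun i => act s'`_i) (fun i => actD _)
  (fun i j => actC _ _).
pose W : lmodType (Zpoly d) := act_type hrho.
have rs x : x \in s' -> exists r : Zpoly d, forall v : V, rho r v = act x v.
  move=> xs; have xd : (index x s' < d)%N by rewrite index_mem.
  by have [r hr] := rt _ xd; exists r => v; rewrite hr nth_index.
have rg g : exists r : Zpoly d, forall x, D1 x -> rho r (p x) = p (x ^ g).
  suff [r [_ [h _]]] : exists r r', (forall x, D1 x -> rho r (p x) = p (x ^ g)) /\
      (forall x, D1 x -> rho r' (p x) = p (x ^ g^-1)) by exists r.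
  apply: (hs [set g | exists r r', (forall x, D1 x -> rho r (p x) = p (x ^ g)) /\
      (forall x, D1 x -> rho r' (p x) = p (x ^ g^-1))]).
    split=> /= [|g1 g2 [r1 [r1' [h1 h1']]] [r2 [r2' [h2 h2']]]|g1 [r1 [r1' [h1 h1']]]].
    - by exists 1%R, 1%R; split=> x _; rewrite ?invg1 conjg1 (act1 hrho).
    - exists (r2 * r1)%R, (r1' * r2')%R; split=> x Tx; rewrite (actM hrho).
        by rewrite h1// h2 ?conjgM//; apply: jD1.
      by rewrite h2'// h1' ?invgM ?conjgM//; apply: jD1.
    - by exists r1', r1; rewrite invgK.
  move=> g1 g1s /=; have [|r hr] := rs g1; first by rewrite mem_cat g1s.
  have [|r' hr'] := rs g1^-1; first by rewrite mem_cat (map_f (fun x => x^-1)) ?orbT.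
  by exists r, r'; split=> x Tx; rewrite ?hr ?hr' actE.
exists (Zpoly d), W, p; split=> //.
- move=> U hU UJ; split; [exact: zsub0|exact: zsubD|].
  have Uact i (y : V) : U y -> U (act s'`_i y).
    by move=> Uy; have [z Tz zy] := ps y; rewrite -zy actE//; apply: UJ => //; rewrite zy.
  have hU' : @is_zsub V U by case: hU => U0 UD UN; split.
  by move=> r x Ux; exact (rU U hU' Uact r x Ux).
- apply: (finite_module_noetherian (@noetherian_Zpoly d)).
  exists [seq p [~ x, y] | x <- s, y <- s] => w U hU sU; have [z Tz <-] := ps w.
  suff [] : (D1 `&` [set x | U (p x)]) z by [].
  apply: derived_sub Tz; first exact: hs.
    split; last first.
      move=> x g [Tx Ux]; split; first exact: jD1.
      by have [r hr] := rg g; rewrite /= -hr//; apply: (submodZ hU).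
    split=> /= [|x y [Tx Ux] [Ty Uy]|x [Tx Ux]]; split=> /=.
    + exact: (subg1 hD1). + by rewrite p1; exact: (submod0 hU).
    + exact: (subgM hD1). + by rewrite pM//; exact: (submodD hU).
    + exact: (subgV hD1). + by rewrite zhomV'//; exact: (submodN hU).
  move=> x y xs ys; split; first exact: mem_derived.
  by apply: sU; apply: allpairs_f.
Qed.

End Metabelian.

Section MetabelianCover.
Local Open Scope group_scope.
Local Open Scope classical_set_scope.
Variable T : groupType.
Hypothesis Tfg : fingen T.
Let D1 : set T := com [set: T] [set: T].
Let L3 : set T := com D1 [set: T].
Let D2 : set T := com D1 D1.
Let hD1 : is_subg D1 := (derived_normal T).1.
Let jD1 : conj_closed D1 := (derived_normal T).2.

Section Module.
Variables (R : comNzRingType) (V : lmodType R) (p : T -> V).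
Hypothesis hp : derived_module p.

Lemma dm1 : p 1 = 0%R.
Proof. exact: (dmK hp (subg1 hD1)).2 (subg1 (derived2_normal T).1). Qed.

Lemma dmV x : D1 x -> p x^-1 = (- p x)%R.
Proof.
move=> Tx; apply: (@addrI _ (p x)); rewrite -(dmM hp) ?mulgV ?dm1 ?subrr//.
exact: (subgV hD1).
Qed.

Lemma dm_comm r g x : (forall y, D1 y -> (r *: p y)%R = p (y ^ g)) -> D1 x ->
  ((r - 1) *: p x)%R = p [~ x, g].
Proof.
move=> hr Tx; have Tg : D1 (x ^ g) := jD1 g Tx; have TV := subgV hD1 Tx.
by rewrite scalerBl scale1r hr// commgEl (dmM hp TV Tg) dmV// addrC.
Qed.

(** The relative augmentation ideal of [A] in the scalars. *)
Definition augmentation (A : set T) (a : R) : Prop := forall J : set R, is_ideal J ->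
  (forall g r, A g -> (forall x, D1 x -> (r *: p x)%R = p (x ^ g)) -> J (r - 1)%R) -> J a.

Lemma augmentation_ideal A : is_ideal (augmentation A).
Proof.
split=> [J hJ _|a b ha hb J hJ h|r a ha J hJ h]; first exact: (submod0 hJ).
  by apply: (submodD hJ); [apply: ha|apply: hb].
by apply: (submodZ hJ); apply: ha.
Qed.

Lemma mem_augmentation A g r : A g -> (forall x, D1 x -> (r *: p x)%R = p (x ^ g)) ->
  augmentation A (r - 1)%R.
Proof. by move=> Ag hr J _; apply; [exact: Ag|]. Qed.

Lemma augmentation_im (A S : set T) (W : set V) : is_submod W ->
  (forall x g, S x -> A g -> W (p [~ x, g])) -> S `<=` D1 ->
  forall a x, augmentation A a -> S x -> W (a *: p x)%R.
Proof.
move=> hW h ST a x ha Sx; apply: (ha [set a | W (a *: p x)%R]).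
  split=> /= [|b c hb hc|r b hb].
  - by rewrite scale0r; exact: (submod0 hW).
  - by rewrite scalerDl; exact: (submodD hW).
  - by rewrite -scalerA; exact: (submodZ hW).
by move=> g r Ag hr /=; rewrite (dm_comm hr); [exact: h|exact: ST].
Qed.

Lemma im_submod (S : set T) : is_normal S -> S `<=` D1 -> is_submod (p @` S).
Proof.
move=> [hS jS] ST; apply: (dm_submod hp).
  split=> [|_ _ [x Sx <-] [y Sy <-]|_ [x Sx <-]].
  - by exists 1; [exact: subg1|exact: dm1].
  - by exists (x * y); [exact: subgM|rewrite (dmM hp)//; exact: ST].
  - by exists x^-1; [exact: subgV|rewrite dmV//; exact: ST].
move=> g x Tx [y Sy yx]; exists (y ^ g); first exact: jS.
by have [r hr] := dm_act hp g; rewrite -!hr ?yx//; exact: ST.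
Qed.

Lemma com_im_ideal_mul (A S : set T) (U W : set V) x : S `<=` D1 -> (forall x, S x -> U (p x)) ->
  com S A x -> ideal_mul (augmentation A) U (p x).
Proof.
move=> ST SU hx; have hI := ideal_mul_submod (augmentation A) U.
suff [] : (D1 `&` [set x | ideal_mul (augmentation A) U (p x)]) x by [].
apply: hx => [|_ [a [b [Sa Ab ->]]]]; last first.
  split; first exact: mem_derived.
  have [r hr] := dm_act hp b; rewrite /= -(dm_comm hr); last exact: ST.
  by apply: mem_ideal_mul; [exact: mem_augmentation hr|exact: SU].
split=> /= [|a b [Ta Ia] [Tb Ib]|a [Ta Ia]]; split=> /=.
- exact: (subg1 hD1). - by rewrite dm1; exact: (submod0 hI).
- exact: (subgM hD1). - by rewrite (dmM hp)//; exact: (submodD hI).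
- exact: (subgV hD1). - by rewrite dmV//; exact: (submodN hI).
Qed.

Variable psi : T -> T.
Hypothesis hpsi : self_cover psi.
Let N : set T := range psi.
Let N1 : set T := com N N.
Hypothesis TN : com [set: T] N `<=` N1.
Hypothesis TNL3 : D1 `<=` mulset N L3.

Let imN : set V := p @` (D1 `&` N).
Let imN1 : set V := p @` N1.
Let augT := augmentation [set: T].
Let augN := augmentation N.
Let augNV : set V := ideal_mul augN [set: V].

Let hN : is_normal N := cover_normal hpsi.

Lemma N1_derived : N1 `<=` D1. Proof. exact: comS. Qed.

Lemma N1_normal : is_normal N1.
Proof. exact: com_normal hN.2 hN.2. Qed.

Lemma imN_submod : is_submod imN.
Proof. by apply: im_submod; [apply: normalI => //; exact: derived_normal|move=> x []]. Qed.

Lemma imN1_submod : is_submod imN1.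
Proof. by apply: im_submod; [exact: N1_normal|exact: N1_derived]. Qed.

Lemma imN1_imN : imN1 `<=` imN.
Proof.
move=> _ [x Nx <-]; exists x => //; split; first exact: N1_derived.
exact: com_subl hN _ Nx.
Qed.

Lemma augN_imN1 a v : augN a -> imN1 (a *: v)%R.
Proof.
move=> ha; have [x Tx <-] := dm_surj hp v.
apply: (augmentation_im (A := N) (S := D1)) => // [|y g _ Ng]; first exact: imN1_submod.
by exists [~ y, g] => //; apply: TN; apply: mem_com.
Qed.

Lemma augT_imN1 a v : augT a -> imN1 v -> ideal_mul augN imN1 (a *: v)%R.
Proof.
move=> ha [x Nx <-]; apply: (augmentation_im (A := setT) (S := N1)) => // [|y g Ny _|].
- exact: ideal_mul_submod.
- apply: (com_im_ideal_mul (S := N1)) => //; first exact: N1_derived.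
    by move=> z Nz; exists z.
  by apply: N1_central.
- exact: N1_derived.
Qed.

Lemma augT_imN a v : augT a -> imN v -> imN1 (a *: v)%R.
Proof.
move=> ha [x Nx <-]; apply: (augmentation_im (A := setT) (S := D1 `&` N)) => //.
  exact: imN1_submod.
move=> y g [_ Ny] _.
exists [~ y, g] => //; rewrite -invgR; apply: (subgV (com_subg _ _)).
by apply: TN; apply: mem_com.
Qed.

Lemma imN_augT_generate v : exists2 w, imN w & ideal_mul augT [set: V] (v - w)%R.
Proof.
have [x Tx <-] := dm_surj hp v; have [n [c [Nn Tc xE]]] := TNL3 Tx.
have T1c : D1 c by exact: lower3_derived Tc.
have T1n : D1 n by apply: (subgMr hD1 T1c); rewrite -xE.
exists (p n); first by exists n.
by rewrite xE (dmM hp)// addrC addKr; apply: (com_im_ideal_mul (S := D1)).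
Qed.

(** Let [Y] be the quotient of [V] by [imN].  By hypothesis [Y = augT * Y], so that
some [ep] in [augT] acts on [Y] as the identity.  On [augNV = augN * V] one has
[ep ^+ 2 * augNV <= augN * augNV], because [augN * V] is contained in [imN1] and
[augT * imN1] in [augN * imN1].  Hence, by the determinant trick, some [c] that
acts on [Y] as the identity kills [augNV].  Finally [ep ^+ 2] maps [imN] into
[augNV].  So [ep ^+ 2 * c] kills [imN] and induces the identity of [Y]: it embeds
[Y] in [V]. *)
Lemma projector_exists : exists e : R, (forall v, imN (v - e *: v)%R) /\
  (forall v, imN v -> (e *: v = 0)%R).
Proof.
have himN := imN_submod; have noeV := dm_noetherian hp.
have [s [_ hs]] := noeV [set: V] (IsSubmod I (fun _ _ _ _ => I) (fun _ _ _ => I)).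
have [j [a [Ia ha]]] : exists j a, augT a /\ forall x, x \in s -> imN ((1 ^+ j + a) *: x)%R.
  apply: ideal_nakayama => //; first exact: augmentation_ideal.
  move=> x xs W hW imN_W IW; have [w imNw hw] := imN_augT_generate x.
  rewrite scale1r -(subrK w x); apply: (submodD hW); last exact: imN_W.
  by apply: (ideal_mul_lspan (s := s) _ hW _ hw) => // u _; exact: hs.
pose ep : R := (- a)%R.
have Iep : augT ep by exact: submodN (augmentation_ideal _) Ia.
have ep_imN v : imN (v - ep *: v)%R.
  rewrite scaleNr opprK -{1}[v]scale1r -scalerDl; apply: (hs v I [set v | imN ((1 + a) *: v)%R]).
    split=> /= [|x y hx hy|r x hx].
    - by rewrite scaler0; exact: (submod0 himN).
    - by rewrite scalerDr; exact: (submodD himN).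
    - by rewrite scalerA mulrC -scalerA; exact: (submodZ himN).
  by move=> x /ha; rewrite expr1n.
have haugNV : is_submod augNV by exact: ideal_mul_submod.
have [t [taugNV ht]] := noeV augNV haugNV.
have ep2 v : augNV v -> ideal_mul augN augNV (ep * ep *: v)%R.
  move=> hv.
  have sc (U : set V) r : is_submod U -> is_submod [set v | U (r *: v)%R].
    move=> hU; split=> /= [|x y hx hy|r' x hx].
    - by rewrite scaler0; exact: (submod0 hU).
    - by rewrite scalerDr; exact: (submodD hU).
    - by rewrite scalerA mulrC -scalerA; exact: (submodZ hU).
  apply: (hv [set v | ideal_mul augN augNV (ep * ep *: v)%R]).
    by apply: sc; exact: ideal_mul_submod.
  move=> b u Ib _ /=; rewrite -scalerA.
  have hbu : ideal_mul augN imN1 (ep *: (b *: u))%R by apply: augT_imN1 => //; exact: augN_imN1.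
  apply: (hbu [set v | ideal_mul augN augNV (ep *: v)%R]) => [|b' u' Ib' Su'].
    by apply: (sc (ideal_mul augN augNV) ep); exact: ideal_mul_submod.
  rewrite /= scalerA mulrC -scalerA; apply: mem_ideal_mul => //.
  by apply: (ideal_mulS (U := imN1)) => //; exact: augT_imN1.
have [k [b [Ib hb]]] : exists k b, augN b /\ forall x, x \in t ->
    [set 0%R : V] (((ep * ep) ^+ k + b) *: x)%R.
  apply: ideal_nakayama; first exact: augmentation_ideal.
    by split=> [|x y -> ->|r x ->] //=; rewrite ?addr0 ?scaler0.
  move=> x xt W hW _ IW; apply: (ideal_mul_lspan (s := t) ht hW IW).
  exact: (ep2 x (taugNV x xt)).
pose c : R := ((ep * ep) ^+ k + b)%R.
have caugNV v : augNV v -> (c *: v = 0)%R.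
  move=> /ht h; apply: (h [set v | (c *: v = 0)%R]) => //.
  split=> /= [|x y hx hy|r x hx]; first by rewrite scaler0.
    by rewrite scalerDr hx hy addr0.
  by rewrite scalerA mulrC -scalerA hx scaler0.
pose id_mod (r : R) := forall v, imN (v - r *: v)%R.
have id_modM r r' : id_mod r -> id_mod r' -> id_mod (r * r')%R.
  move=> hr hr' v.
  have -> : (v - (r * r') *: v = (v - r' *: v) + (r' *: v - r *: (r' *: v)))%R.
    by rewrite scalerA addrA subrK.
  by apply: (submodD himN); [exact: hr'|exact: hr].
have id_modX r n : id_mod r -> id_mod (r ^+ n)%R.
  move=> hr; elim: n => [|n IH]; last by rewrite exprS; exact: id_modM.
  by move=> v; rewrite expr0 scale1r subrr; exact: (submod0 himN).
exists (ep * ep * c)%R; split=> v.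
  apply: (id_modM); first exact: id_modM.
  move=> {}v; rewrite /c scalerDl opprD addrA; apply: (submodB himN).
    by apply: (id_modX); exact: id_modM.
  by apply: imN1_imN; exact: augN_imN1.
move=> imNv; rewrite mulrC -!scalerA; apply: caugNV.
have : ideal_mul augN imN1 (ep *: (ep *: v))%R by apply: augT_imN1 => //; exact: augT_imN.
exact: ideal_mulS.
Qed.

End Module.

(** The operator [e] of [projector_exists] identifies the finite quotient [Y] of [V]
with a finite submodule of [V]; by [noetherian_finite_part] its order is bounded
in terms of [V], that is, of [T]. *)
Lemma cover_metabelian_index : exists m, forall psi : T -> T, self_cover psi ->
  com [set: T] (range psi) `<=` com (range psi) (range psi) ->
  D1 `<=` mulset (range psi) L3 ->
  index_le D1 (mulset (D1 `&` range psi) D2) m.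
Proof.
have [R [V [p hp]]] := derived_module_exists Tfg.
have /finite_seqP[s sE] := noetherian_finite_part (dm_noetherian hp).
exists (size s).+1 => psi hpsi TN TNL3.
have [e [eid e_imN]] := projector_exists hp hpsi TN TNL3.
exists (fun x => inord (index (e *: p x)%R s)) => x y Tx Ty.
have es v : (e *: v)%R \in s.
  suff : [set` s] (e *: v)%R by [].
  rewrite -sE /=; have [_ _ hN [m [f hf]]] := hpsi.
  have /choice[l hl] : forall v, exists x, D1 x /\ p x = v.
    by move=> w; have [z Tz zw] := dm_surj hp w; exists z.
  have fe u w : f (l u) = f (l w) -> (e *: u = e *: w)%R.
    move=> /(hf _ _ I I) Nuw; have [Tu pu] := hl u; have [Tw pw] := hl w.
    apply/eqP; rewrite eq_sym -subr_eq0 -scalerBr; apply/eqP/e_imN.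
    exists ((l u)^-1 * l w).
      by split=> //; apply: (subgM hD1) => //; exact: (subgV hD1).
    by rewrite (dmM hp)// ?(dmV hp)// ?pu ?pw 1?addrC//; exact: (subgV hD1).
  pose g (i : 'I_m) : V := if pselect (exists v, f (l v) = i) is left h
    then (e *: projT1 (cid h))%R else 0%R.
  apply: (sub_finite_set (B := range g)); last exact: finite_image.
  move=> _ [r _ <-]; exists (f (l (r *: v)%R)) => //.
  rewrite /g; case: pselect => [h|[]]; last by exists (r *: v)%R.
  by case: cid => w /= /fe ->; rewrite scalerA mulrC -scalerA.
move=> /(congr1 val); rewrite /= !inordK ?ltnS ?index_size// => ie.
have {ie} exy : (e *: p x = e *: p y)%R.
  by rewrite -(nth_index 0%R (es (p x))) ie nth_index.
have Txy : D1 (x^-1 * y) by apply: (subgM hD1) => //; exact: (subgV hD1).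
have [n [Tn Nn] pn] : (p @` (D1 `&` range psi)) (p (x^-1 * y)).
  have := eid (p (x^-1 * y)); rewrite {2}(dmM hp)//; last exact: (subgV hD1).
  by rewrite (dmV hp)// scalerDr scalerN exy addNr subr0.
exists n, (n^-1 * (x^-1 * y)); rewrite mulVKg; split=> //.
apply/(dmK hp); first by apply: (subgM hD1) => //; exact: (subgV hD1).
by rewrite (dmM hp)// ?(dmV hp)// ?pn ?addNr//; exact: (subgV hD1).
Qed.

End MetabelianCover.

(** * Chains become abelian *)

Section Core.
Local Open Scope group_scope.
Local Open Scope classical_set_scope.
Variable T : groupType.
Hypothesis Tfg : fingen T.

(** Let [A l] be the derived subgroup of [N l].  The sections [A l / P l k] have
bounded order, so for [l] large [N l] acts on them as [N k] does, that is,
trivially.  Since [A l] is contained in [N k * [A l, N l]], this gives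
[A l <= N k * [A l, A l]]: the derived subgroup of [N l / N k] is perfect.  It is
also solvable. *)
Lemma chain_central_abelian phi : cover_chain phi ->
  (forall k, com [set: T] (range (phi k)) `<=` com (range (phi k)) (range (phi k))) ->
  exists L, forall l k, (L <= l <= k)%N ->
    com (range (phi l)) (range (phi l)) `<=` range (phi k).
Proof.
move=> hphi TN; pose N k := range (phi k); pose A k := com (N k) (N k).
have hN k : is_normal (N k) by apply: cover_normal; exact: chain_cover.
have hA k : is_normal (A k) by apply: com_normal; exact: (hN k).2.
have [L2 hL2] := chain_class_two Tfg hphi TN.
have [m hm] := cover_metabelian_index Tfg.
pose P l k := mulset (A l `&` N k) (com (A l) (A l)).
have hP l k : is_normal (P l k).
  apply: mulset_normal; first exact: normalI.
  by apply: com_normal; exact: (hA l).2.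
have APm (i : {lk : nat * nat | (L2 <= lk.1 <= lk.2)%N}) :
    index_le (A (sval i).1) (P (sval i).1 (sval i).2) m.
  case: i => -[l k] /= lk; have /andP[_ lek] := lk.
  have hl := chain_cover hphi l; have hlM := cover_hom hl.
  have [psi [hpsi psiE]] := chain_factor hphi lek.
  have psiN := factor_range psiE.
  have T2N : com [set: T] [set: T] `<=` mulset (range psi) (com (com [set: T] [set: T]) [set: T]).
    move=> x Tx; have : A l (phi l x) by rewrite /A /N -(im_derived hl); exists x.
    move=> /(hL2 l k lk)[_ [c [[y _ <-] hc xE]]].
    have : (phi l @` com (com [set: T] [set: T]) [set: T]) c.
      by rewrite (im_com hlM) (im_derived hl).
    move=> [c' hc' cE]; exists (psi y), c'; split=> //.
    by apply: (cover_inj hl); rewrite xE hlM psiE cE.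
  have := cover_index_im hl (hm psi hpsi (factor_central hl psiE (TN k)) T2N).
  rewrite (im_derived hl); apply: index_leS => // _ [_ [n [t [[Tn Nn] Tt ->]]] <-].
  exists (phi l n), (phi l t); split; last exact: hlM.
    split; first by rewrite /A /N -(im_derived hl); exists n.
    by rewrite /N -psiN; exists n.
  by rewrite /A /N -(im_derived hl) -(im_com hlM); exists t.
have [L3 hL3] := action_stabilises Tfg (chain_desc hphi)
  (fun i : {lk : nat * nat | (L2 <= lk.1 <= lk.2)%N} => hA (sval i).1)
  (fun i => hP (sval i).1 (sval i).2) APm.
exists (maxn L2 L3) => l k; rewrite geq_max -andbA => /and3P[L2l L3l lk].
have L2lk : (L2 <= l <= k)%N by rewrite L2l.
have comP : com (A l) (N l) `<=` P l k.
  apply: com_min => [|x g Ax Ng]; first exact: (hP l k).1.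
  have [|h Nh /(_ (exist _ (l, k) L2lk) x Ax) /= hx] := hL3 l k _ g Ng; first by rewrite L3l.
  have -> : [~ x, g] = [~ x, h^-1 * g] * [~ x, h] ^ (h^-1 * g).
    by rewrite /commg /conjg !gnorm.
  apply: (subgM (hP l k).1) => //; apply: (hP l k).2.
  apply: mulsetl; first exact: com_subg.
  by split; [exact: (normalRl _ (hA l))|exact: (normalRr _ (hN k))].
have AP : A l `<=` mulset (N k) (com (A l) (A l)).
  move=> x Ax; have [r [c [Nr hc xE]]] := hL2 l k L2lk x Ax.
  have Ac : A l c by exact: (com_subl (hA l)) hc.
  have Ar : A l r by apply: (subgMr (hA l).1 Ac); rewrite -xE.
  have : P l k x.
    rewrite xE; apply: (subgM (hP l k).1); last exact: comP.
    by apply: mulsetl; [exact: com_subg|].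
  by move=> [n [t [[_ Nn] ht ->]]]; exists n, t.
have AD i : A l `<=` mulset (N k) (der i (A l)).
  elim: i => [|i IH]; first by apply: mulsetr; exact: (hN k).1.
  move=> x /AP[n [t [Nn ht ->]]].
  have [n' [t' [Nn' ht' ->]]] := der_mod (i := 1%N) (hN k) IH ht.
  exists (n * n'), t'; rewrite mulgA; split=> //; exact: (subgM (hN k).1).
have [psi [hpsi psiE]] := chain_factor hphi lk.
have [j hj] := self_cover_solvable Tfg hpsi.
have hl := chain_cover hphi l.
move=> x /(AD j)[n [t [Nn ht ->]]]; apply: (subgM (hN k).1) => //.
have : der j (N l) t by apply: derS ht; exact: com_subl.
rewrite /N -(im_der _ _ (cover_hom hl)) => -[y /hj Ny <-].
by rewrite -(factor_range psiE); exists y.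
Qed.

(** The chain below [phi L1] is read inside [T], where it satisfies the hypothesis
of [chain_central_abelian]. *)
Lemma chain_eventually_abelian (phi : nat -> T -> T) : cover_chain phi ->
  exists L, forall l k, (L <= l <= k)%N ->
    com (range (phi l)) (range (phi l)) `<=` range (phi k).
Proof.
move=> hphi; have [L1 hL1] := chain_eventually_central Tfg hphi.
have [phi' [hphi' phiE]] := chain_shift L1 hphi; have h1 := chain_cover hphi L1.
have TN k : com [set: T] (range (phi' k)) `<=` com (range (phi' k)) (range (phi' k)).
  move=> z hz; have : com (range (phi L1)) (phi L1 @` range (phi' k)) (phi L1 z).
    by rewrite -(im_com (cover_hom h1)); exists z.
  rewrite (factor_range (phiE k)) => hz'.
  have := hL1 L1 (L1 + k)%N; rewrite leqnn leq_addr => /(_ isT _ hz').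
  rewrite -(factor_range (phiE k)) -(im_com (cover_hom h1)) => -[z' hz2 /(cover_inj h1) <-].
  exact: hz2.
have [L2 hL2] := chain_central_abelian hphi' TN.
exists (L1 + L2)%N => l k /andP[Ll lk].
have L1l : (L1 <= l)%N by exact: leq_trans (leq_addr _ _) Ll.
have L1k := leq_trans L1l lk.
rewrite -(subnKC L1l) -(subnKC L1k) -!(factor_range (phiE _)) -(im_com (cover_hom h1)).
move=> _ [x hx <-]; exists x => //; apply: hL2 hx.
by rewrite leq_subRL// Ll leq_sub2r.
Qed.

End Core.

(** * Torsion-free finitely generated abelian groups are free *)

Section FreeAbelian.
Local Open Scope ring_scope.
Local Open Scope classical_set_scope.
Variable V : zmodType.

Definition lincomb d (g : 'I_d -> V) (c : 'I_d -> int) : V := \sum_k g k *~ c k.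

Definition generates d (g : 'I_d -> V) := forall x, exists c, x = lincomb g c.

(** Adding a multiple of one generator to another and changing the coefficients
contragrediently preserves linear combinations. *)
Lemma lincomb_transvection d (g : 'I_d -> V) (i j : 'I_d) (s : int) c : i != j ->
  lincomb (fun k => if k == j then g j + g i *~ s else g k)
          (fun k => if k == i then c i - s * c j else c k) = lincomb g c.
Proof.
move=> ij; have ji : j != i by rewrite eq_sym.
rewrite /lincomb (bigD1 i)//= [RHS](bigD1 i)//= (bigD1 j)//= [in RHS](bigD1 j)//=.
rewrite !eqxx (negPf ij) (negPf ji) mulrzBr mulrzDl mulrzA addrACA !addrA; congr (_ + _).
  by rewrite mulrzA_C addrAC addrNK.
by apply: eq_bigr => k /andP[/negPf-> /negPf->].
Qed.

(** Euclid's algorithm on the coefficients of a relation, by transvections of the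
generators, ends with a relation that has a single nonzero coefficient; by
torsion-freeness the corresponding generator is zero. *)
Lemma smaller_generators d (g : 'I_d.+1 -> V) (a : 'I_d.+1 -> int) :
  (forall x n, (0 < n)%N -> x *+ n = 0 :> V -> x = 0) ->
  generates g -> lincomb g a = 0 -> (exists k, a k != 0) ->
  exists g' : 'I_d -> V, generates g'.
Proof.
move=> tf; have [n] := ubnP (\sum_k `|a k|)%N; elim: n => // n IH in g a *.
move=> an gg ga0 [i ai0].
have [j /andP[ij aj0]|a0] := pickP (fun j => (i != j) && (a j != 0)); last first.
  have gi0 : g i = 0.
    move: ga0; rewrite /lincomb (bigD1 i)//= big1 ?addr0 => [|k ki]; last first.
      by have := a0 k; rewrite eq_sym ki /= => /negbFE/eqP->; rewrite mulr0z.
    move=> h; apply: (tf _ `|a i|%N); first by rewrite absz_gt0.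
    case: (a i) h => m /=; first by rewrite pmulrn.
    by rewrite NegzE mulrNz => /eqP; rewrite oppr_eq0 -pmulrn => /eqP.
  exists (fun k => g (fintype.lift i k)) => x; have [c ->] := gg x.
  exists (fun k => c (fintype.lift i k)); rewrite /lincomb (bigD1_ord i)//= gi0 mul0rz add0r.
  by [].
have step (i' j' : 'I_d.+1) : i' != j' -> a i' != 0 -> a j' != 0 -> (`|a j'| <= `|a i'|)%N ->
    exists g' : 'I_d -> V, generates g'.
  move=> ij' ai' aj' le_ji.
  have [s hs] : exists s : int, (`|(a i' - s * a j')%R|%N < `|a i'|%N)%N.
    have [ss|ss] := boolP ((0 < a i') == (0 < a j')).
      by exists 1; move: ss ai' aj' le_ji; lia.
    by exists (-1); move: ss ai' aj' le_ji; lia.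
  pose g' k := if k == j' then g j' + g i' *~ s else g k.
  pose a' k := if k == i' then a i' - s * a j' else a k.
  apply: (IH g' a').
  - rewrite -ltnS; apply: leq_trans an; rewrite ltnS (bigD1 i')//= [X in (_ < X)%N](bigD1 i')//=.
    rewrite /a' eqxx -addSn leq_add// eq_leq//.
    by apply: eq_bigr => k /negPf->.
  - move=> x; have [c ->] := gg x; eexists.
    by rewrite -(lincomb_transvection g s c ij').
  - by rewrite lincomb_transvection.
  - by exists j'; rewrite /a' (eq_sym j') (negPf ij').
have [le_ji|/ltnW le_ij] := leqP `|a j| `|a i|; first exact: (step i j).
by apply: (step j i) => //; rewrite eq_sym.
Qed.

(** A generating family of least size admits no relation. *)
Lemma fg_torsion_free_basis : fg_zmod V ->
  (forall x n, (0 < n)%N -> x *+ n = 0 :> V -> x = 0) ->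
  exists d (g : 'I_d -> V), generates g /\ forall c, lincomb g c = 0 -> forall k, c k = 0.
Proof.
move=> [s hs] tf.
have ex : exists d, `[< exists g : 'I_d -> V, generates g >].
  exists (size s); apply/asboolP; exists (fun i => s`_i).
  apply: (hs [set x | exists c, x = lincomb (fun i : 'I_(size s) => s`_i) c]).
    split=> /= [|x y [c ->] [c' ->]|x [c ->]].
    - by exists (fun=> 0); rewrite /lincomb big1// => k _; rewrite mulr0z.
    - exists (fun k => c k + c' k); rewrite /lincomb -big_split; apply: eq_bigr => k _.
      by rewrite mulrzDr.
    - exists (fun k => - c k); rewrite /lincomb -sumrN; apply: eq_bigr => k _.
      by rewrite mulrNz.
  move=> x xs; have xsz : (index x s < size s)%N by rewrite index_mem.
  exists (fun k => if k == Ordinal xsz then 1 else 0).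
  rewrite /lincomb (bigD1 (Ordinal xsz))//= eqxx nth_index// big1 ?addr0// => k /negPf->.
  by rewrite mulr0z.
have [d /asboolP[g gg] dmin] := ex_minnP ex; exists d, g; split=> // c gc0 k.
apply/eqP/negPn/negP => ck; case: d => [|d] in g gg dmin c gc0 k ck *; first by case: k ck.
have [g' gg'] := smaller_generators tf gg gc0 (ex_intro _ k ck).
by have := dmin d; rewrite ltnn => /(_ (asboolT (ex_intro _ g' gg'))).
Qed.

End FreeAbelian.

Section FreeGroup.
Local Open Scope group_scope.
Local Open Scope classical_set_scope.

Lemma fg_torsion_free_free_abelian (A : groupType) : fingen A ->
  (forall x y : A, x * y = y * x) ->
  (forall (x : A) n, (0 < n)%N -> x ^+ n = 1 -> x = 1) -> free_abelian A.
Proof.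
move=> Afg Acomm Atf.
have hX : is_normal [set 1 : A].
  split=> [|x g ->]; last by rewrite conj1g.
  by split=> [|x y -> ->|x ->] //=; rewrite ?mulg1 ?invg1.
have [|V [p [pM pK ps]]] := abelian_quotient_exists (subgT A) hX.
  apply: com_min => [|x y _ _]; first exact: hX.1.
  by apply/eqP/commgP; exact: Acomm.
have pM' x y : p (x * y) = (p x + p y)%R by exact: pM.
have ps' v : exists x, p x = v by have [x _ <-] := ps v; exists x.
have tf (v : V) n : (0 < n)%N -> (v *+ n = 0)%R -> v = 0%R.
  move=> n0; have [x <-] := ps' v; rewrite -(zhomX pM') => /(pK _ I) /(Atf _ _ n0) ->.
  by apply/pK.
have [d [g [gg gi]]] := fg_torsion_free_basis (fg_zmod_im Afg pM' ps') tf.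
have /choice[c hc] : forall x, exists c, p x = lincomb g c by move=> x; exact: gg.
have lincombB c1 c2 : lincomb g (fun k => c1 k - c2 k)%R = (lincomb g c1 - lincomb g c2)%R.
  by rewrite /lincomb -sumrB; apply: eq_bigr => k _; rewrite mulrzBr.
have cU c1 c2 : lincomb g c1 = lincomb g c2 -> c1 =1 c2.
  move=> h k; apply/eqP; rewrite -subr_eq0; apply/eqP.
  by apply: (gi (fun k => c1 k - c2 k)%R); rewrite lincombB h subrr.
pose sg (e : 'I_d -> int) : {freeg 'I_d / int} := (\sum_k Freeg [:: (e k, k)])%R.
have sgE e k : coeff k (sg e) = e k.
  rewrite /sg raddf_sum (bigD1 k)//= coeffU eqxx mulr1 big1 ?addr0// => j jk.
  by rewrite coeffU (negPf jk) mulr0.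
exists 'I_d, (fun x => sg (c x)); split; last first.
  move=> x y; apply/eqP/freeg_eqP => k.
  rewrite coeffD !sgE; apply: (cU (c (x * y)) (fun k => c x k + c y k)%R).
  rewrite -hc pM' !hc /lincomb -big_split; apply: eq_bigr => j _.
  by rewrite mulrzDr.
have /choice[h hh] : forall D : {freeg 'I_d / int}, exists x, p x = lincomb g (fun k => coeff k D).
  by move=> D; exact: ps'.
exists h => [x|D]; last first.
  apply/eqP/freeg_eqP => k; rewrite sgE.
  by apply: (cU (c (h D)) (fun k => coeff k D)); rewrite -hc hh.
have : p (h (sg (c x))) = p x.
  by rewrite hh hc /lincomb; apply: eq_bigr => k _; rewrite sgE.
move=> /eqP; rewrite -subr_eq0 -(zhomV pM') -pM' => /eqP/(pK _ I) h1.
by apply/eqP; rewrite -divg_eq1; apply/eqP.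
Qed.

End FreeGroup.

(** * The limit of the chain *)

Section Final.
Local Open Scope group_scope.
Local Open Scope classical_set_scope.

(** Modulo the intersection [X] of the chain, [range (phi L)] is a finitely generated
abelian group.  Its torsion subgroup is finite, and each nonzero element of it
is missed by some member of the chain. *)
Lemma chain_eventually_torsion_free (T : groupType) (phi : nat -> T -> T) :
  fingen T -> cover_chain phi -> exists L, forall l, (L <= l)%N ->
    (forall k, com (range (phi l)) (range (phi l)) `<=` range (phi k)) /\
    forall x n, range (phi l) x -> (0 < n)%N -> (forall k, range (phi k) (x ^+ n)) ->
      forall k, range (phi k) x.
Proof.
move=> Tfg hphi; have [L hL] := chain_eventually_abelian Tfg hphi.
have hN k : is_normal (range (phi k)) by apply: cover_normal; exact: chain_cover.
pose X : set T := [set x | forall k, range (phi k) x].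
have hX : is_normal X.
  split=> [|x g Xx k]; last exact: (hN k).2 _ _ (Xx k).
  split=> [k|x y Xx Xy k|x Xx k]; first exact: (subg1 (hN k).1).
    exact: (subgM (hN k).1).
  exact: (subgV (hN k).1).
have LX l : (L <= l)%N -> com (range (phi l)) (range (phi l)) `<=` X.
  move=> Ll x hx k; have [lk|/ltnW kl] := leqP l k; first by apply: hL hx; rewrite Ll.
  by apply: (chain_mono hphi kl); exact: (com_subl (hN l)) hx.
have hLc := chain_cover hphi L.
have [V [p [pM pK ps]]] := abelian_quotient_exists (hN L).1 hX (LX L (leqnn L)).
have NL x : range (phi L) (phi L x) by exists x.
have Vfg : fg_zmod V.
  apply: (@fg_zmod_im T V (fun x => p (phi L x)) Tfg) => [x y|v].
    by rewrite (cover_hom hLc) pM.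
  by have [_ [x _ <-] <-] := ps v; exists x.
have /finite_seqP[s sE] := noetherian_finite_part (fg_zmod_noetherian Vfg).
have zhomX' x n : range (phi L) x -> p (x ^+ n) = (p x *+ n)%R.
  move=> Nx; elim: n => [|n IH]; first by apply/(pK _ (subg1 (hN L).1)); exact: (subg1 hX.1).
  by rewrite expgS pM ?IH ?mulrS//; exact: (subgX _ (hN L).1).
have tors v n : (0 < n)%N -> (v *+ n = 0)%R -> v \in s.
  move=> n0 vn; suff : [set` s] v by [].
  rewrite -sE /=; apply: (sub_finite_set (B := range (fun i : 'I_n => (v *+ i)%R)));
    last exact: finite_image.
  move=> _ [r _ <-]; have rn : (`|(r %% n)%Z|%N < n)%N.
    by rewrite -ltz_nat gez0_abs ?modz_ge0 -?lt0n// ltz_pmod.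
  exists (Ordinal rn) => //=; rewrite -[(r *: v)%R]/(v *~ r)%R {2}(divz_eq r n) mulrzDr.
  rewrite mulrC mulrzA -pmulrn vn mul0rz add0r.
  by rewrite pmulrn gez0_abs// modz_ge0 -?lt0n.
have /choice[w hw] : forall v, exists x, range (phi L) x /\ p x = v.
  by move=> v; have [x Nx px] := ps v; exists x.
have /choice[kap hkap] : forall x, exists k, X x \/ ~ range (phi k) x.
  move=> x; have [Xx|/existsNP[k hk]] := pselect (X x); first by exists 0%N; left.
  by exists k; right.
exists (maxn L (\max_(v <- s) kap (w v))) => l; rewrite geq_max => /andP[Ll kl].
split=> [k x hx|x n Nx n0 xn]; first exact: (LX l Ll).
have NLx : range (phi L) x by exact: (chain_mono hphi Ll).
have pxs : p x \in s.
  by apply: (tors _ n n0); rewrite -zhomX'//; apply/pK => //; exact: (subgX _ (hN L).1).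
have [Nw pw] := hw (p x).
have Xwx : X ((w (p x))^-1 * x).
  have NV := subgV (hN L).1 Nw; apply/pK; first exact: (subgM (hN L).1).
  have -> : p ((w (p x))^-1 * x) = p ((w (p x))^-1 * w (p x)) by rewrite !pM// pw.
  by rewrite mulVg; apply/(pK _ (subg1 (hN L).1)); exact: (subg1 hX.1).
have Xw : X (w (p x)).
  have [//|] := hkap (w (p x)); case.
  have kk : (kap (w (p x)) <= l)%N by exact: leq_trans (leq_bigmax_seq _ pxs isT) kl.
  have := subgM (hN (kap (w (p x)))).1 (chain_mono hphi kk Nx) (subgV (hN _).1 (Xwx _)).
  by rewrite invgM invgK mulVKg.
by have := subgM hX.1 Xw Xwx; rewrite mulVKg.
Qed.

Lemma groupClosed_subg (G : groupType) (H : groupClosed G) : is_subg [set x | x \in H].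
Proof. by split=> [|x y|x] /=; [exact: gpred1|exact: gpredM|rewrite gpredV]. Qed.

Lemma normalClosed_normal (G : groupType) (H : normalClosed G) :
  is_normal [set x | x \in H].
Proof. by split; [exact: groupClosed_subg|move=> x g; exact: gpredJ_normal]. Qed.

Lemma fingen_finitely_generated (G : groupType) : finitely_generated G -> fingen G.
Proof.
move=> [s hs]; exists s => H hH sH x.
suff : x \in sset hH by move/ssetP.
by apply: hs => y /sH Hy; apply/ssetP.
Qed.

Lemma fingen_im (G A : groupType) (f : G -> A) : is_hom f -> (forall a, exists x, f x = a) ->
  fingen G -> fingen A.
Proof.
move=> fM fs [s hs]; exists (map f s) => H hH sH a; have [x <-] := fs a.
by apply: (hs _ (preim_subg fM hH)) => y ys; apply: sH; apply: map_f.
Qed.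

Lemma finite_index_le (G : groupType) (H : groupClosed G) : finite_index H ->
  exists m, index_le [set: G] [set x | x \in H] m.
Proof.
move=> /finite_seqP[s sE]; exists (size s).+1, (fun x => inord (index (lcoset H x) s)).
have cs x : lcoset H x \in s by suff : [set` s] (lcoset H x) by []; rewrite -sE; exists x.
move=> x y _ _ /(congr1 val); rewrite /= !inordK ?ltnS ?index_size// => ie.
have : lcoset H y y by rewrite /lcoset /= mulVg gpred1.
by rewrite -(nth_index set0 (cs y)) -ie nth_index.
Qed.

Lemma covers_of_isomorphic (G : groupType) (H : normalClosed G) :
  finite_index H -> isomorphic (subg_type H) G ->
  exists2 psi : G -> G, self_cover psi & range psi = [set x | x \in H].
Proof.
move=> Hfin [f [g fK gK]].
have gM x y : g (x * y) = g x * g y.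
  by apply: (can_inj fK); rewrite gmulfM !gK.
have vE : range (fun x => val (g x)) = [set x | x \in H].
  apply/seteqP; split=> [_ [x _ <-]|x /= Hx]; first exact: (svalP (g x)).
  by exists (f (exist _ x Hx)) => //; rewrite fK.
exists (fun x => val (g x)) => //; split.
- by move=> x y; rewrite gM valM.
- by move=> x y /val_inj /(can_inj gK).
- by rewrite vE; exact: normalClosed_normal.
- by rewrite vE; exact: finite_index_le.
Qed.

Section QuotientMap.
Variables (H : groupType) (X : normalClosed H).
Definition quotg_pi (x : H) : quotg X := (\pi_(quotg X) x)%qT.
Fact quotg_pi1 : quotg_pi 1 = 1. Proof. by []. Qed.
Fact quotg_piM : {morph quotg_pi : x y / x * y}.
Proof. by move=> x y; rewrite /quotg_pi -quotg_mulE. Qed.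
HB.instance Definition _ := isUMagmaMorphism.Build H (quotg X) quotg_pi (quotg_pi1, quotg_piM).
Lemma quotg_piP x y : quotg_pi x = quotg_pi y <-> x^-1 * y \in X.
Proof. by split=> [/quotg_eqP|h]; [|apply/quotg_eqP]. Qed.
Lemma quotg_pi_surj u : exists x, quotg_pi x = u.
Proof. by elim/quotW: u => x; exists x. Qed.
End QuotientMap.

Lemma abelian_normal (A : groupType) (S : set A) : (forall x y : A, x * y = y * x) ->
  is_subg S -> is_normal S.
Proof. by move=> Acomm hS; split=> // x g Sx; rewrite /conjg Acomm mulgK. Qed.

End Final.

Local Open Scope classical_set_scope.

Theorem corollary1p5 (G : groupType) (Gam : nat -> normalClosed G)
    (G_fg : finitely_generated G)
    (Gam_desc : forall k, {subset Gam k.+1 <= Gam k})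
    (Gam_index : forall k, finite_index (Gam k))
    (Gam_iso : forall k, isomorphic (subg_type (Gam k)) G) :
  exists L : nat, forall l : nat, (L <= l)%N ->
    free_abelian (subquotg (Gam l) (bigcapg Gam)) /\
    exists (A : groupType)
           (pi : UMagmaMorphism.type (subg_type (Gam l)) A)
           (A_ : nat -> groupClosed A),
      [/\ free_abelian A,
          range pi = [set: A] &
          forall k : nat, (l <= k)%N ->
            finite_index (A_ k) /\
            [set x : G | x \in Gam k] =
              val @` [set u : subg_type (Gam l) | pi u \in A_ k]].
Proof.
have Gfg := fingen_finitely_generated G_fg.
have /choice[phi hphi] : forall k, exists psi : G -> G,
    self_cover psi /\ range psi = [set x | x \in Gam k].
  by move=> k; have [psi h1 h2] := covers_of_isomorphic (Gam_index k) (Gam_iso k); exists psi.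
have phiE k x : range (phi k) x <-> x \in Gam k by rewrite (hphi k).2.
have chain_phi : cover_chain phi.
  split=> k; first by case: (hphi k).
  by move=> x /phiE /Gam_desc /phiE.
have [L hL] := chain_eventually_torsion_free Gfg chain_phi.
have Gmono l k x : (l <= k)%N -> x \in Gam k -> x \in Gam l.
  by move=> lk /phiE h; apply/phiE; exact: (chain_mono chain_phi lk).
exists L => l Ll; have [comX tf] := hL l Ll.
pose H := subg_type (Gam l); pose X := traceg (Gam l) (bigcapg Gam).
have XP (u : H) : reflect (forall k, val u \in Gam k) (u \in X).
  exact: (bigcapgP Gam (val u)).
pose A : groupType := subquotg (Gam l) (bigcapg Gam).
pose pi (u : H) : A := quotg_pi X u.
have piM : is_hom pi by exact: quotg_piM.
have Acomm (a b : A) : (a * b = b * a)%g.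
  have [u <-] := quotg_pi_surj a; have [v <-] := quotg_pi_surj b.
  rewrite -!quotg_piM; apply/quotg_piP/XP => k; apply/phiE/comX.
  have -> : val ((u * v)^-1 * (v * u))%g = [~ val v, val u]%g.
    by rewrite /commg /conjg !(valM, gmulfV) !gnorm.
  by apply: mem_com; apply/phiE; [exact: (svalP v)|exact: (svalP u)].
have Afree : free_abelian A.
  apply: fg_torsion_free_free_abelian => // [|a n n0].
    apply: (fingen_im piM); first exact: quotg_pi_surj.
    have [f [g fK gK]] := Gam_iso l; apply: (fingen_im (f := g)) Gfg => [x y|u].
      by apply: (can_inj fK); rewrite gmulfM !gK.
    by exists (f u).
  have [u <-] := quotg_pi_surj a; rewrite -(homX piM) -(hom1 piM).
  move=> /esym/quotg_piP/XP un; apply/esym/quotg_piP/XP => k.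
  rewrite invg1 mul1g; apply/phiE; apply: (tf _ n) => //; first by apply/phiE; exact: (svalP u).
  move=> j; apply/phiE; have := un j; rewrite invg1 mul1g.
  suff -> : val (u ^+ n)%g = (val u ^+ n)%g by [].
  exact: homX (fun x y => valM x y) u n.
split=> //.
pose B k : set A := pi @` [set u | val u \in Gam k].
have hB k : is_normal (B k).
  apply: (abelian_normal Acomm); apply: (im_subg piM).
  have valM' : is_hom (val : H -> G) by move=> x y; exact: valM.
  exact: (preim_subg valM' (groupClosed_subg (Gam k))).
exists A, (quotg_pi X : UMagmaMorphism.type _ _), (fun k => nset (hB k)); split=> //.
  by apply/seteqP; split=> // a _; have [u <-] := quotg_pi_surj a; exists u.
move=> k lk; split; last first.
  apply/seteqP; split=> [x /= xk|_ [u /nsetP[v vk /quotg_piP/XP/(_ k) h] <-]].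
    exists (exist _ x (Gmono _ _ _ lk xk)) => //.
    by apply/nsetP; exists (exist _ x (Gmono _ _ _ lk xk)).
  have := gpredM _ _ vk h; rewrite valM gmulfV mulVKg.
  exact.
have [m [f hf]] := finite_index_le (Gam_index k).
have /choice[w hw] : forall a : A, exists u : H, pi u = a by move=> a; exact: quotg_pi_surj.
pose c (i : 'I_m) : set A := if pselect (exists a, f (val (w a)) = i) is left h
  then lcoset (nset (hB k)) (projT1 (cid h)) else set0.
rewrite /finite_index; apply: (sub_finite_set (B := range c)); last exact: finite_image.
move=> _ [a _ <-]; exists (f (val (w a))) => //.
rewrite /c; case: pselect => [h|[]]; last by exists a.
case: cid => b /= fab; have Bab : B k (b^-1 * a)%g.
  rewrite -(hw a) -(hw b) -(homV piM) -piM; exists ((w b)^-1 * w a)%g => //.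
  have E : val ((w b)^-1 * w a)%g = ((val (w b))^-1 * val (w a))%g.
    by rewrite valM gmulfV.
  by rewrite /mkset E; apply: hf.
apply/seteqP; split=> y /nsetP By; apply/nsetP.
  have -> : (a^-1 * y = (b^-1 * a)^-1 * (b^-1 * y))%g by rewrite !gnorm.
  by apply: (subgM (hB k).1) By; exact: (subgV (hB k).1).
have -> : (b^-1 * y = (b^-1 * a) * (a^-1 * y))%g by rewrite !gnorm.
exact: (subgM (hB k).1).
Qed.
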